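(* Let $k$ be a field, let $a\ge 1$, $d\ge 1$ and $b\in\{1,2,3\}$ be integers, put $m_0=3a+b$, $m_i=m_0+id$ for $i=1,2,3$, and assume $\gcd(m_0,m_1,m_2,m_3)=1$. Let $C\subset\mathbb{A}^4$ be the monomial curve with parametrization $x_0=t^{m_0},\ x_1=t^{m_1},\ x_2=t^{m_2},\ y=t^{m_3}$, let $R=k[x_0,x_1,x_2,y]$, and let $G\cong R/I(C)^*$ be the associated graded ring (coordinate ring of the tangent cone of $C$ at the origin). Then the sequence of $R$-modules $$0\longrightarrow R^{\beta_3(b)}\xrightarrow{\phi_3(b)}R^{\beta_2(b)}\xrightarrow{\phi_2(b)}R^{\beta_1(b)}\xrightarrow{\phi_1(b)}R\xrightarrow{\phi}G\longrightarrow 0$$ is a minimal free resolution of $G$ (the tangent cone of $C$), where $\phi$ is the canonical surjection, $$(\beta_1(b),\beta_2(b),\beta_3(b))=\begin{cases}(6,8,3)& b=1,\\(5,5,1)& b=2,\\(4,5,2)& b=3,\end{cases}$$ and the maps are given by the following matrices. For $b=1$: $$\phi_1(1)=\begin{pmatrix}x_1^2-x_0x_2& x_1x_2-x_0y& x_2^2-x_1y& x_1y^a& x_2y^a& y^{a+1}\end{pmatrix},$$ $$\phi_2(1)=\begin{pmatrix} x_2& y^a& -y&0&0&0&0&0\\ -x_1&0&x_2&y^a&0&0&0&0\\ x_0&0&-x_1&0&y^a&0&0&0\\ 0&-x_1&0&-x_2&0&x_2&y&0\\ 0&x_0&0&0&-x_2&-x_1&0&y\\ 0&0&0&x_0&x_1&0&-x_1&-x_2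 \end{pmatrix},\qquad \phi_3(1)=\begin{pmatrix} y^a&0&0\\ -x_2&y&0\\ 0&y^a&0\\ x_1&-x_2&0\\ -x_0&x_1&0\\ 0&-x_2&y\\ 0&x_1&-x_2\\ 0&-x_0&x_1 \end{pmatrix}.$$ For $b=2$: $$\phi_1(2)=\begin{pmatrix}x_1^2-x_0x_2& x_1x_2-x_0y& x_2^2-x_1y& x_2y^a& y^{a+1}\end{pmatrix},$$ $$\phi_2(2)=\begin{pmatrix} x_2&-y&0&0&0\\ -x_1&x_2&y^a&0&0\\ x_0&-x_1&0&y^a&0\\ 0&0&-x_1&-x_2&y\\ 0&0&x_0&x_1&-x_2 \end{pmatrix},\qquad \phi_3(2)=\begin{pmatrix} y^{a+1}\\ x_2y^a\\ -x_2^2+x_1y\\ x_1x_2-x_0y\\ x_1^2-x_0x_2 \end{pmatrix}.$$ For $b=3$: $$\phi_1(3)=\begin{pmatrix}x_1^2-x_0x_2& x_1x_2-x_0y& x_2^2-x_1y& y^{a+1}\end{pmatrix},$$ $$\phi_2(3)=\begin{pmatrix} x_2&y^{a+1}&-y&0&0\\ -x_1&0&x_2&y^{a+1}&0\\ x_0&0&-x_1&0&y^{a+1}\\ 0&-x_1^2+x_0x_2&0&-x_1x_2+x_0y&-x_2^2+x_1y \end{pmatrix},\qquad \phi_3(3)=\begin{pmatrix} y^{a+1}&0\\ -x_2&y\\ 0&y^{a+1}\\ x_1&-x_2\\ -x_0&x_1 \end{pmatrix}.$$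
   Context: $I(C)$ is the kernel of the $k$-algebra homomorphism $R=k[x_0,x_1,x_2,y]\to k[t]$, $x_0\mapsto t^{m_0}$, $x_1\mapsto t^{m_1}$, $x_2\mapsto t^{m_2}$, $y\mapsto t^{m_3}$. For a nonzero polynomial $f$, $f^*$ denotes its homogeneous summand of least degree (standard grading, all variables of degree 1), and $I(C)^*$ is the ideal generated by all $f^*$ with $0\neq f\in I(C)$; it is the defining ideal of the tangent cone of $C$ at the origin. Let $A=k[[t^{m_0},t^{m_1},t^{m_2},t^{m_3}]]$ with maximal ideal $m=(t^{m_0},t^{m_1},t^{m_2},t^{m_3})$. The associated graded ring is $G=\mathrm{gr}_m(A)=\bigoplus_{i\ge 0}m^i/m^{i+1}$, and $G\cong R/I(C)^*$ via the surjection $\phi:R\to G$ sending $x_0,x_1,x_2,y$ to the classes of $t^{m_0},t^{m_1},t^{m_2},t^{m_3}$ in $m/m^2$. Matrices act on column vectors. A minimal free resolution is an exact complex of free modules in which all entries of the matrices $\phi_i(b)$, $i=1,2,3$, lie in the ideal $(x_0,x_1,x_2,y)$. *)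

(* Defs.v *)
From HB Require Import structures.
From mathcomp Require Import all_boot all_order all_algebra.
From mathcomp Require Import generic_quotient ring_quotient.
From mathcomp Require Import mpoly.
From mathcomp Require Import boolp.

Set Implicit Arguments.
Unset Strict Implicit.
Unset Printing Implicit Defensive.

Import GRing.Theory.
Local Open Scope ring_scope.

Section Ideals.
Variable A : comNzRingType.
Implicit Types (S I : A -> Prop) (x y : A).

Definition ideal_gen S x : Prop :=
  exists s : seq (A * A),
    (forall q, q \in s -> S q.2) /\ x = \sum_(q <- s) q.1 * q.2.

Definition ideal_pow I (i : nat) : A -> Prop :=
  ideal_gen (fun x => exists s : seq A,
    [/\ size s = i, forall y, y \in s -> I y & x = \prod_(y <- s) y]).

Lemma ideal_gen_sub S x : S x -> ideal_gen S x.
Proof.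
move=> Sx; exists [:: (1, x)]; split; last by rewrite big_seq1 mul1r.
by move=> q; rewrite inE => /eqP ->.
Qed.

Lemma ideal_gen0 S : ideal_gen S 0.
Proof. by exists [::]; split=> //; rewrite big_nil. Qed.

Lemma ideal_genD S x y : ideal_gen S x -> ideal_gen S y -> ideal_gen S (x + y).
Proof.
move=> [s [Ss ->]] [r [Sr ->]]; exists (s ++ r); split; last by rewrite big_cat.
by move=> q; rewrite mem_cat => /orP[/Ss|/Sr].
Qed.

Lemma ideal_genM S x y : ideal_gen S y -> ideal_gen S (x * y).
Proof.
move=> [s [Ss ->]]; exists [seq (x * q.1, q.2) | q <- s]; split.
  by move=> _ /mapP[q qs ->] /=; exact: Ss.
by rewrite big_map mulr_sumr; apply: eq_bigr => q _; rewrite mulrA.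
Qed.

Lemma ideal_genN S x : ideal_gen S x -> ideal_gen S (- x).
Proof. by rewrite -mulN1r; exact: ideal_genM. Qed.

Lemma ideal_gen_sum S (T : eqType) (r : seq T) (F : T -> A) :
  (forall i, i \in r -> ideal_gen S (F i)) -> ideal_gen S (\sum_(i <- r) F i).
Proof.
move=> SF; rewrite big_seq; apply: big_ind; last exact: SF.
  exact: ideal_gen0.
exact: ideal_genD.
Qed.

Lemma ideal_pow0 I x : ideal_pow I 0 x.
Proof.
rewrite -[x]mulr1; apply/ideal_genM/ideal_gen_sub.
by exists [::]; split=> //; rewrite big_nil.
Qed.

Lemma ideal_pow1 I x : I x -> ideal_pow I 1 x.
Proof.
move=> Ix; apply: ideal_gen_sub; exists [:: x]; split=> //; last by rewrite big_seq1.
by move=> y; rewrite inE => /eqP ->.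
Qed.

Lemma ideal_powM I i j x y :
  ideal_pow I i x -> ideal_pow I j y -> ideal_pow I (i + j) (x * y).
Proof.
move=> [s [Ss ->]] [r [Sr ->]]; rewrite mulr_suml.
apply: ideal_gen_sum => q qs; rewrite mulr_sumr.
apply: ideal_gen_sum => p pr; rewrite mulrACA; apply/ideal_genM/ideal_gen_sub.
have [u [<- Iu ->]] := Ss _ qs; have [v [<- Iv ->]] := Sr _ pr.
exists (u ++ v); split; rewrite ?size_cat ?big_cat //.
by move=> z; rewrite mem_cat => /orP[/Iu|/Iv].
Qed.

End Ideals.

(* [gr_I(A)] as the quotient of the Rees algebra [\bigoplus_i I^i T^i] (a subring of
   [{poly A}]) by [\bigoplus_i I^(i+1) T^i]; in degree [i] this is
   [I^i / I^(i+1)], with the product induced by that of [A]. *)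
Section AssociatedGraded.
Variables (A : comNzRingType) (I : A -> Prop).

Definition rees_pred : {poly A} -> bool :=
  fun p => `[< forall i, ideal_pow I i p`_i >].

Lemma rees_predP (p : {poly A}) :
  reflect (forall i, ideal_pow I i p`_i) (p \in rees_pred).
Proof. exact: asboolP. Qed.

Lemma rees_subring : subring_closed rees_pred.
Proof.
split.
- apply/rees_predP=> -[|i]; first exact: ideal_pow0.
  by rewrite coef1; exact: ideal_gen0.
- move=> p q /rees_predP Ip /rees_predP Iq; apply/rees_predP => i.
  by rewrite coefB; apply: ideal_genD; [exact: Ip | exact/ideal_genN/Iq].
- move=> p q /rees_predP Ip /rees_predP Iq; apply/rees_predP => i.
  rewrite coefM; apply: ideal_gen_sum => j _.
  by rewrite -[in ideal_gen _](subnKC (leq_ord j)); exact: ideal_powM.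
Qed.

HB.instance Definition _ :=
  GRing.isSubringClosed.Build {poly A} rees_pred rees_subring.

Record rees := Rees { rees_val :> {poly A}; _ : rees_val \in rees_pred }.

HB.instance Definition _ := [isSub for rees_val].
HB.instance Definition _ := [Choice of rees by <:].
HB.instance Definition _ := [SubChoice_isSubComNzRing of rees by <:].

Lemma rees_valP (p : rees) i : ideal_pow I i (rees_val p)`_i.
Proof. by case: p => p /= /rees_predP. Qed.

Lemma rees_val0 : rees_val 0 = 0.
Proof. exact: (raddf0 (val : rees -> {poly A})). Qed.

Lemma rees_val1 : rees_val 1 = 1.
Proof. exact: (rmorph1 (val : rees -> {poly A})). Qed.

Lemma rees_valB p q : rees_val (p - q) = rees_val p - rees_val q.
Proof. exact: (raddfB (val : rees -> {poly A})). Qed.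

Lemma rees_valM p q : rees_val (p * q) = rees_val p * rees_val q.
Proof. exact: (rmorphM (val : rees -> {poly A})). Qed.

Definition rees_ideal : rees -> bool :=
  fun p => `[< forall i, ideal_pow I i.+1 (rees_val p)`_i >].

Lemma rees_idealP (p : rees) :
  reflect (forall i, ideal_pow I i.+1 (rees_val p)`_i) (p \in rees_ideal).
Proof. exact: asboolP. Qed.

Lemma rees_ideal_zmod : zmod_closed rees_ideal.
Proof.
split.
  by apply/rees_idealP => i; rewrite rees_val0 coef0; exact: ideal_gen0.
move=> p q /rees_idealP Ip /rees_idealP Iq; apply/rees_idealP => i.
by rewrite rees_valB coefB; apply: ideal_genD; [exact: Ip | exact/ideal_genN/Iq].
Qed.

Lemma rees_idealMr p q : q \in rees_ideal -> p * q \in rees_ideal.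
Proof.
move=> /rees_idealP Iq; apply/rees_idealP => i.
rewrite rees_valM coefM; apply: ideal_gen_sum => j _.
rewrite -[in ideal_gen _](subnKC (leq_ord j)) -addnS.
by apply: ideal_powM => //; exact: rees_valP.
Qed.

HB.instance Definition _ :=
  GRing.isZmodClosed.Build rees rees_ideal rees_ideal_zmod.

(* [{ideal_quot _}] is not used because it requires a proper ideal;
   hence also the [pzRing] (not [nzRing]) structure on [gr] below. *)
Definition rees_zmod_ideal : zmodClosed rees :=
  GRing.ZmodClosed.clone rees rees_ideal _.

Local Notation gr_quot := (Quotient.quot rees_zmod_ideal).

Definition gr : Type := gr_quot.

HB.instance Definition _ := GRing.Zmodule.on gr.

Definition gr_pi (p : rees) : gr := (\pi_gr_quot p)%qT.

Lemma gr_piP p q : gr_pi p = gr_pi q <-> p - q \in rees_ideal.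
Proof.
by rewrite Quotient.idealrBE; split=> [pq|/eqP //]; apply/eqP.
Qed.

Lemma gr_pi_surj (g : gr) : exists p, gr_pi p = g.
Proof. by exists (repr (g : gr_quot)); rewrite /gr_pi reprK. Qed.

Lemma gr_pi_additive : zmod_morphism gr_pi.
Proof. exact: (raddfB \pi_gr_quot%qT). Qed.

HB.instance Definition _ := GRing.isZmodMorphism.Build rees gr gr_pi gr_pi_additive.

Definition gr_repr (g : gr) : rees := repr (g : gr_quot).
Definition gr_one : gr := gr_pi 1.
Definition gr_mul (g h : gr) : gr := gr_pi (gr_repr g * gr_repr h).

Lemma gr_reprK : cancel gr_repr gr_pi.
Proof. by move=> g; rewrite /gr_pi /gr_repr reprK. Qed.

Lemma gr_pi_mul p q : gr_pi (p * q) = gr_mul (gr_pi p) (gr_pi q).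
Proof.
apply/gr_piP; have Ip := gr_reprK (gr_pi p); have Iq := gr_reprK (gr_pi q).
move/esym/gr_piP: Ip => Ip; move/esym/gr_piP: Iq => Iq.
rewrite -(subrKA (p * gr_repr (gr_pi q))) -mulrBr -mulrBl.
apply: (@rpredD _ rees_zmod_ideal); first exact: rees_idealMr.
by rewrite mulrC; exact: rees_idealMr.
Qed.

Fact gr_mulA : associative gr_mul.
Proof.
move=> x y z; rewrite -[x]gr_reprK -[y]gr_reprK -[z]gr_reprK.
by rewrite -!gr_pi_mul mulrA.
Qed.

Fact gr_mulC : commutative gr_mul.
Proof. by move=> x y; rewrite /gr_mul mulrC. Qed.

Fact gr_mul1 : left_id gr_one gr_mul.
Proof. by move=> x; rewrite -[x]gr_reprK -gr_pi_mul mul1r. Qed.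

Fact gr_mulDl : left_distributive gr_mul +%R.
Proof.
move=> x y z; rewrite -[x]gr_reprK -[y]gr_reprK -[z]gr_reprK.
by rewrite -raddfD -!gr_pi_mul -raddfD mulrDl.
Qed.

HB.instance Definition _ :=
  GRing.Zmodule_isComPzRing.Build gr gr_mulA gr_mulC gr_mul1 gr_mulDl.

Fact gr_pi_monoid : monoid_morphism gr_pi.
Proof. by split=> // p q; rewrite gr_pi_mul. Qed.

HB.instance Definition _ :=
  GRing.isMonoidMorphism.Build rees gr gr_pi gr_pi_monoid.

End AssociatedGraded.

Section PowerSeries.
Variable k : fieldType.

Definition pseries : Type := nat -> k.
Implicit Types f g h : pseries.

HB.instance Definition _ := gen_eqMixin pseries.
HB.instance Definition _ := gen_choiceMixin pseries.

Definition ps_zero : pseries := fun=> 0.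
Definition ps_one : pseries := fun n => (n == 0)%:R.
Definition ps_opp f : pseries := fun n => - f n.
Definition ps_add f g : pseries := fun n => f n + g n.
Definition ps_mul f g : pseries := fun n => \sum_(j < n.+1) f j * g (n - j)%N.

Fact ps_addA : associative ps_add.
Proof. by move=> f g h; apply/funext => n; exact: addrA. Qed.
Fact ps_addC : commutative ps_add.
Proof. by move=> f g; apply/funext => n; exact: addrC. Qed.
Fact ps_add0 : left_id ps_zero ps_add.
Proof. by move=> f; apply/funext => n; exact: add0r. Qed.
Fact ps_addN : left_inverse ps_zero ps_opp ps_add.
Proof. by move=> f; apply/funext => n; exact: addNr. Qed.

HB.instance Definition _ :=
  GRing.isZmodule.Build pseries ps_addA ps_addC ps_add0 ps_addN.

Let trunc N f : {poly k} := \poly_(i < N.+1) f i.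

Let ps_mulE N f g n : (n <= N)%N ->
  ps_mul f g n = (trunc N f * trunc N g)`_n.
Proof.
move=> nN; rewrite coefM; apply: eq_bigr => j _.
rewrite !coef_poly !ltnS (leq_trans (leq_ord j) nN).
by rewrite (leq_trans (leq_subr _ _) nN).
Qed.

Fact ps_mulA : associative ps_mul.
Proof.
move=> f g h; apply/funext => n.
transitivity (trunc n f * (trunc n g * trunc n h))`_n.
  rewrite coefM; apply: eq_bigr => j _.
  by rewrite coef_poly ltnS leq_ord (ps_mulE _ _ (leq_subr j n)).
rewrite mulrA coefM; apply: eq_bigr => j _.
by rewrite [(trunc n h)`__]coef_poly ltnS leq_subr -ps_mulE ?leq_ord.
Qed.

Fact ps_mulC : commutative ps_mul.
Proof.
by move=> f g; apply/funext => n; rewrite !(ps_mulE _ _ (leqnn n)) mulrC.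
Qed.

Fact ps_mul1 : left_id ps_one ps_mul.
Proof.
move=> f; apply/funext => n; rewrite /ps_mul big_ord_recl big1 ?addr0.
  by rewrite /ps_one mul1r subn0.
by move=> j _; rewrite /ps_one mul0r.
Qed.

Fact ps_mulDl : left_distributive ps_mul +%R.
Proof.
move=> f g h; apply/funext => n; rewrite [RHS]/GRing.add /= /ps_add /ps_mul.
by rewrite -big_split; apply: eq_bigr => j _; exact: mulrDl.
Qed.

Fact ps_one_neq0 : ps_one != 0 :> pseries.
Proof.
by apply/eqP => /(congr1 (fun f => f 0%N)) /eqP; rewrite (oner_eq0 k).
Qed.

HB.instance Definition _ := GRing.Zmodule_isComNzRing.Build pseries
  ps_mulA ps_mulC ps_mul1 ps_mulDl ps_one_neq0.

Definition ps_monom (c : k) (e : nat) : pseries := fun n => c *+ (n == e).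

End PowerSeries.

Section MonomialCurve.
Variables (k : fieldType) (n : nat) (w : 'I_n -> nat).

Local Notation R := {mpoly k[n]}.

(* The vanishing ideal of the curve with parametrization [x_j = t^(w j)]. *)
Definition curve_ideal (f : R) : Prop :=
  mmap (@polyC k) (fun j => 'X^(w j)) f = 0.

(* As [mdeg e < msize f] for every [e] in [msupp f], the default value is
   only attained at [f = 0]. *)
Definition mpoly_order (f : R) : nat :=
  \big[minn/msize f]_(e <- msupp f) mdeg e.

Definition initial_form (f : R) : R := pihomog mdeg (mpoly_order f) f.

Definition tangent_cone_ideal : R -> Prop :=
  ideal_gen (fun g => exists f,
    [/\ f != 0, curve_ideal f & g = initial_form f]).

Definition in_semigroup (s : nat) : Prop :=
  exists e : 'I_n -> nat, s = (\sum_j e j * w j)%N.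

(* [k[[t^(w 0), ..., t^(w (n-1))]]]: the power series in [t] all of whose
   exponents lie in the semigroup generated by the [w j]. *)
Definition curve_pred : pseries k -> bool :=
  fun f => `[< forall s, f s != 0 -> in_semigroup s >].

Lemma curve_predP f :
  reflect (forall s, f s != 0 -> in_semigroup s) (f \in curve_pred).
Proof. exact: asboolP. Qed.

Lemma in_semigroup0 : in_semigroup 0.
Proof. by exists (fun=> 0%N); rewrite big1. Qed.

Lemma in_semigroupD s r :
  in_semigroup s -> in_semigroup r -> in_semigroup (s + r).
Proof.
move=> [e ->] [e' ->]; exists (fun j => (e j + e' j)%N).
by rewrite -big_split; apply: eq_bigr => j _; rewrite mulnDl.
Qed.

Lemma in_semigroup_gen j : in_semigroup (w j).
Proof.
exists (fun i => (i == j) : nat); rewrite (bigD1 j) //= eqxx mul1n big1 ?addn0 //.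
by move=> i /negPf ->.
Qed.

Lemma curve_subring : subring_closed curve_pred.
Proof.
split.
- apply/curve_predP => -[_|s]; first exact: in_semigroup0.
  by rewrite [X in X != _](_ : _ = 0) ?eqxx.
- move=> f g /curve_predP Af /curve_predP Ag; apply/curve_predP => s.
  have [f0|/Af//] := eqVneq (f s) 0; have [g0|/Ag//] := eqVneq (g s) 0.
  by rewrite [X in X != _](_ : _ = f s - g s) // f0 g0 subrr eqxx.
- move=> f g /curve_predP Af /curve_predP Ag; apply/curve_predP => s.
  move=> fgs; apply: contrapT => nA; move/eqP: fgs; apply; apply: big1 => j _.
  have [->|/Af Aj] := eqVneq (f j) 0; first by rewrite mul0r.
  have [->|/Ag Asj] := eqVneq (g (s - j)%N) 0; first by rewrite mulr0.
  by case: nA; rewrite -(subnKC (leq_ord j)); exact: in_semigroupD.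
Qed.

HB.instance Definition _ :=
  GRing.isSubringClosed.Build (pseries k) curve_pred curve_subring.

Record curve_ring :=
  CurveRing { curve_val :> pseries k; _ : curve_val \in curve_pred }.

HB.instance Definition _ := [isSub for curve_val].
HB.instance Definition _ := [Choice of curve_ring by <:].
HB.instance Definition _ := [SubChoice_isSubComNzRing of curve_ring by <:].

Lemma curve_monom_in c s : in_semigroup s -> ps_monom c s \in curve_pred.
Proof.
move=> As; apply/curve_predP => r; rewrite /ps_monom.
by have [->|] := eqVneq r s; rewrite ?mulr0n ?eqxx.
Qed.

Definition curve_const (c : k) : curve_ring :=
  CurveRing (curve_monom_in c in_semigroup0).

Definition curve_gen (j : 'I_n) : curve_ring :=
  CurveRing (curve_monom_in 1 (in_semigroup_gen j)).

Definition curve_max : curve_ring -> Prop :=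
  ideal_gen (fun f => exists j, f = curve_gen j).

Fact curve_const_additive : zmod_morphism curve_const.
Proof.
by move=> b c; apply/val_inj/funext => s; rewrite /= /ps_monom mulrnBl.
Qed.

Fact curve_const_monoid : monoid_morphism curve_const.
Proof.
split; first by apply/val_inj/funext => s.
move=> b c; apply/val_inj/funext => -[|s].
  by rewrite /= {2}/GRing.mul /= /ps_mul big_ord1.
rewrite /= [LHS]mulr0n {1}/GRing.mul /= /ps_mul big1 // => j _.
rewrite /ps_monom; case: (val j) => [|i]; last by rewrite mulr0n mul0r.
by rewrite subn0 [X in _ * X]mulr0n mulr0.
Qed.

HB.instance Definition _ :=
  GRing.isZmodMorphism.Build k curve_ring curve_const curve_const_additive.
HB.instance Definition _ :=
  GRing.isMonoidMorphism.Build k curve_ring curve_const curve_const_monoid.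

Local Notation B := (rees curve_max).

Lemma rees_const_in (c : k) : (curve_const c)%:P \in rees_pred curve_max.
Proof.
apply/rees_predP => -[|i]; first exact: ideal_pow0.
by rewrite coefC; exact: ideal_gen0.
Qed.

Lemma rees_gen_in (j : 'I_n) : curve_gen j *: 'X \in rees_pred curve_max.
Proof.
apply/rees_predP => i; rewrite coefZ coefX.
have [->|_] := eqVneq i 1%N; last by rewrite mulr0; exact: ideal_gen0.
by rewrite mulr1; apply/ideal_pow1/ideal_gen_sub; exists j.
Qed.

Definition rees_const (c : k) : B := Rees (rees_const_in c).
Definition rees_gen (j : 'I_n) : B := Rees (rees_gen_in j).

Fact rees_const_additive : zmod_morphism rees_const.
Proof. by move=> b c; apply/val_inj; rewrite /= !raddfB. Qed.

Fact rees_const_monoid : monoid_morphism rees_const.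
Proof.
split; first by apply/val_inj; rewrite /= !rmorph1.
by move=> b c; apply/val_inj; rewrite /= !rmorphM.
Qed.

HB.instance Definition _ :=
  GRing.isZmodMorphism.Build k B rees_const rees_const_additive.
HB.instance Definition _ :=
  GRing.isMonoidMorphism.Build k B rees_const rees_const_monoid.

Definition tangent_ring : Type := gr curve_max.

HB.instance Definition _ := GRing.ComPzRing.on tangent_ring.

(* The [k]-algebra morphism sending ['X_j] to the class of [t^(w j)] in
   [m / m^2]. *)
Definition tangent_map (f : R) : tangent_ring :=
  gr_pi (mmap rees_const rees_gen f).

Fact tangent_map_additive : zmod_morphism tangent_map.
Proof. by move=> f g; rewrite /tangent_map !raddfB. Qed.

Fact tangent_map_monoid : monoid_morphism tangent_map.
Proof.
split; first by rewrite /tangent_map !rmorph1.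
by move=> f g; rewrite /tangent_map !rmorphM.
Qed.

HB.instance Definition _ :=
  GRing.isZmodMorphism.Build R tangent_ring tangent_map tangent_map_additive.
HB.instance Definition _ :=
  GRing.isMonoidMorphism.Build R tangent_ring tangent_map tangent_map_monoid.

Definition tangent_scale (f : R) (g : tangent_ring) : tangent_ring :=
  tangent_map f * g.

Fact tangent_scaleA f g x :
  tangent_scale f (tangent_scale g x) = tangent_scale (f * g) x.
Proof. by rewrite /tangent_scale rmorphM mulrA. Qed.
Fact tangent_scale1 : left_id 1 tangent_scale.
Proof. by move=> x; rewrite /tangent_scale rmorph1 mul1r. Qed.
Fact tangent_scaleDr : right_distributive tangent_scale +%R.
Proof. by move=> f x y; exact: mulrDr. Qed.
Fact tangent_scaleDl x : {morph tangent_scale^~ x : f g / f + g}.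
Proof. by move=> f g; rewrite /tangent_scale rmorphD mulrDl. Qed.

HB.instance Definition _ := GRing.Zmodule_isLmodule.Build R tangent_ring
  tangent_scaleA tangent_scale1 tangent_scaleDr tangent_scaleDl.

Definition tangent_surj : R^o -> tangent_ring := tangent_map.

Fact tangent_surj_linear : linear tangent_surj.
Proof. by move=> c f g; rewrite /tangent_surj rmorphD rmorphM. Qed.

HB.instance Definition _ :=
  GRing.isLinear.Build R R^o tangent_ring _ tangent_surj tangent_surj_linear.

End MonomialCurve.

Section Resolution.
Variables (k : fieldType) (n : nat).
Local Notation R := {mpoly k[n]}.

Definition exact_at (U V W : lmodType R)
    (f : {linear U -> V}) (g : {linear V -> W}) : Prop :=
  forall v, g v = 0 <-> exists u, f u = v.

Definition row_map b (D : 'M[R]_(1, b)) (v : 'cV[R]_b) : R^o := (D *m v) 0 0.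

Fact row_map_linear b (D : 'M[R]_(1, b)) : linear (row_map D).
Proof. by move=> c u v; rewrite /row_map linearP !mxE. Qed.

HB.instance Definition _ b (D : 'M[R]_(1, b)) :=
  GRing.isLinear.Build R 'cV[R]_b R^o _ (row_map D) (row_map_linear D).

Definition col_map a b (D : 'M[R]_(a, b)) : {linear 'cV[R]_b -> 'cV[R]_a} :=
  mulmx D.

Definition variables_ideal : R -> Prop :=
  ideal_gen (fun f => exists j : 'I_n, f = 'X_j).

Definition minimal_mx a b (D : 'M[R]_(a, b)) : Prop :=
  forall i j, variables_ideal (D i j).

Record minimal_free_resolution (M : lmodType R) b1 b2 b3
    (D3 : 'M[R]_(b2, b3)) (D2 : 'M[R]_(b1, b2)) (D1 : 'M[R]_(1, b1))
    (eps : {linear R^o -> M}) : Prop := MinimalFreeResolution {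
  mfr_inj : injective (col_map D3);
  mfr_exact2 : exact_at (col_map D3) (col_map D2);
  mfr_exact1 : exact_at (col_map D2) (row_map D1);
  mfr_exact0 : exact_at (row_map D1) eps;
  mfr_surj : forall g : M, exists f, eps f = g;
  mfr_min1 : minimal_mx D1;
  mfr_min2 : minimal_mx D2;
  mfr_min3 : minimal_mx D3 }.

End Resolution.

Definition arith_weight (a b d : nat) (i : 'I_4) : nat := (3 * a + b + i * d)%N.

(* The functions below are only meaningful for [b] in [{1, 2, 3}]; the last
   branch is the case [b = 3]. *)
Definition beta1 (b : nat) : nat :=
  match b with 1 => 6 | 2 => 5 | _ => 4 end.
Definition beta2 (b : nat) : nat :=
  match b with 1 => 8 | 2 => 5 | _ => 5 end.
Definition beta3 (b : nat) : nat :=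
  match b with 1 => 3 | 2 => 1 | _ => 2 end.

Section Matrices.
Variable k : fieldType.
Local Notation R := {mpoly k[4]}.

Definition mx_of_rows m n (rows : seq (seq R)) : 'M[R]_(m, n) :=
  \matrix_(i < m, j < n) nth 0 (nth [::] rows i) j.

Let x0 : R := 'X_(@Ordinal 4 0 isT).
Let x1 : R := 'X_(@Ordinal 4 1 isT).
Let x2 : R := 'X_(@Ordinal 4 2 isT).
Let y : R := 'X_(@Ordinal 4 3 isT).

Definition phi1 (a b : nat) : 'M[R]_(1, beta1 b) :=
  match b return 'M[R]_(1, beta1 b) with
  | 1 => mx_of_rows _ _
      [:: [:: x1 ^+ 2 - x0 * x2; x1 * x2 - x0 * y; x2 ^+ 2 - x1 * y;
              x1 * y ^+ a; x2 * y ^+ a; y ^+ a.+1]]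
  | 2 => mx_of_rows _ _
      [:: [:: x1 ^+ 2 - x0 * x2; x1 * x2 - x0 * y; x2 ^+ 2 - x1 * y;
              x2 * y ^+ a; y ^+ a.+1]]
  | _ => mx_of_rows _ _
      [:: [:: x1 ^+ 2 - x0 * x2; x1 * x2 - x0 * y; x2 ^+ 2 - x1 * y;
              y ^+ a.+1]]
  end.

Definition phi2 (a b : nat) : 'M[R]_(beta1 b, beta2 b) :=
  match b return 'M[R]_(beta1 b, beta2 b) with
  | 1 => mx_of_rows _ _
      [:: [:: x2;   y ^+ a; - y;  0;      0;      0;    0;    0];
          [:: - x1; 0;      x2;   y ^+ a; 0;      0;    0;    0];
          [:: x0;   0;      - x1; 0;      y ^+ a; 0;    0;    0];
          [:: 0;    - x1;   0;    - x2;   0;      x2;   y;    0];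
          [:: 0;    x0;     0;    0;      - x2;   - x1; 0;    y];
          [:: 0;    0;      0;    x0;     x1;     0;    - x1; - x2]]
  | 2 => mx_of_rows _ _
      [:: [:: x2;   - y;  0;      0;      0];
          [:: - x1; x2;   y ^+ a; 0;      0];
          [:: x0;   - x1; 0;      y ^+ a; 0];
          [:: 0;    0;    - x1;   - x2;   y];
          [:: 0;    0;    x0;     x1;     - x2]]
  | _ => mx_of_rows _ _
      [:: [:: x2;   y ^+ a.+1; - y;  0;         0];
          [:: - x1; 0;         x2;   y ^+ a.+1; 0];
          [:: x0;   0;         - x1; 0;         y ^+ a.+1];
          [:: 0; - x1 ^+ 2 + x0 * x2; 0; - (x1 * x2) + x0 * y;
              - x2 ^+ 2 + x1 * y]]
  end.

Definition phi3 (a b : nat) : 'M[R]_(beta2 b, beta3 b) :=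
  match b return 'M[R]_(beta2 b, beta3 b) with
  | 1 => mx_of_rows _ _
      [:: [:: y ^+ a; 0;      0];
          [:: - x2;   y;      0];
          [:: 0;      y ^+ a; 0];
          [:: x1;     - x2;   0];
          [:: - x0;   x1;     0];
          [:: 0;      - x2;   y];
          [:: 0;      x1;     - x2];
          [:: 0;      - x0;   x1]]
  | 2 => mx_of_rows _ _
      [:: [:: y ^+ a.+1];
          [:: x2 * y ^+ a];
          [:: - x2 ^+ 2 + x1 * y];
          [:: x1 * x2 - x0 * y];
          [:: x1 ^+ 2 - x0 * x2]]
  | _ => mx_of_rows _ _
      [:: [:: y ^+ a.+1; 0];
          [:: - x2;      y];
          [:: 0;         y ^+ a.+1];
          [:: x1;        - x2];
          [:: - x0;      x1]]
  end.

End Matrices.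

(* Main.v *)
Require Import Defs.
From HB Require Import structures.
From mathcomp Require Import all_boot all_order all_algebra.
From mathcomp Require Import mpoly boolp.
From mathcomp Require Import ring zify.

(** Put m0 = 3a + b, and give the monomial x0^e0 x1^e1 x2^e2 y^e3 its degree
    i = e0 + e1 + e2 + e3 and its twist j = e1 + 2 e2 + 3 e3; on the curve it
    takes the value t^(i m0 + j d).  The quadrics A = x1^2 - x0 x2,
    B = x1 x2 - x0 y and C = x2^2 - x1 y are differences of monomials of equal
    degree and twist.  They generate the ideal T of the twisted cubic, and modulo
    T a monomial only depends on its degree and twist ([monomial_cong_std]).

    The tangent cone.  Let J be the ideal generated by the entries of phi1: it
    contains T, and x_r y^a for b <= r <= 3, where x_3 = y.  Then J is contained in
    the ideal of initial forms, that ideal in the kernel of the map to the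
    associated graded ring, and that kernel in J.
    - The identity (3a + b) d = m0 d says that x_(j+b) y^a and x_j x0^(a+d) have
      the same weight; the first has the smaller degree, so it is an initial
      form ([tangent_cone_power]).
    - If f vanishes on the curve, then its initial form, of degree o, takes the
      same value there as the opposite of terms of degree > o, hence a value in
      m^(o+1) ([tangent_map_initial_form]).
    - A power series in m^(i+1) is supported on the weights of monomials of degree
      > i ([supp_ge_pow]).  As m0 and d are coprime, i m0 + j d is not such a
      weight when j < m0 ([weight_bound]).  So if f is in the kernel, then the
      coefficients of f on the monomials of degree i and twist j < m0 add up to 0
      ([kernel_bicoef]); normal monomials of twist j >= m0 are in J
      ([std_monomial_in]), and therefore f is in J ([tangent_kernel_sub]).
    The map to the associated graded ring is onto because a power series of the
    curve ring without constant term is a combination of the four generators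
    ([curve_max_const0]).

    The resolution.  T has the Hilbert-Burch resolution with the 2 x 2 minors of
    the matrix of rows (x0, x1, x2) and (x1, x2, y).  It is proved exact by hand
    ([cubic_syzygy]): the product of a syzygy v with A, B or C is a combination
    of the two columns, so for c = x1^3 - x0^2 y = x1 A + x0 B both c v and C v are
    such combinations, and c, C is a regular sequence.  The quotient J / T is
    y^a times the ideal (x1, x2, y), (x2, y) or (y) of R / T, and T is prime, so
    the last rows of phi2 only have to describe the syzygies modulo T of those
    variables ([cubic_x1x2y_syzygy], [cubic_x2y_syzygy]) or of 1.  The three
    exactness statements are then proved as for a mapping cone: the last rows are
    solved first, and after a subtraction there remains a syzygy of T.
    Minimality can be read off the entries. *)

Set Implicit Arguments.
Unset Strict Implicit.
Unset Printing Implicit Defensive.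

Import GRing.Theory.
Local Open Scope ring_scope.

(** * Ideals as predicates *)

Definition is_ideal (A : comNzRingType) (I : A -> Prop) : Prop :=
  [/\ I 0, forall f g, I f -> I g -> I (f + g) & forall c f, I f -> I (c * f)].

Section IsIdeal.
Variables (A : comNzRingType) (I : A -> Prop).
Hypothesis idI : is_ideal I.

Lemma is_ideal0 : I 0. Proof. by case: idI. Qed.

Lemma is_idealD f g : I f -> I g -> I (f + g).
Proof. by case: idI => _ + _; apply. Qed.

Lemma is_idealM c f : I f -> I (c * f).
Proof. by case: idI => _ _; apply. Qed.

Lemma is_idealMr c f : I f -> I (f * c).
Proof. by rewrite mulrC; exact: is_idealM. Qed.

Lemma is_ideal_trans f g h : I (f - g) -> I (g - h) -> I (f - h).
Proof. by move=> fg gh; rewrite -(subrKA g); exact: is_idealD. Qed.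

Lemma is_ideal_sum (T : Type) (r : seq T) (P : pred T) (F : T -> A) :
  (forall i, P i -> I (F i)) -> I (\sum_(i <- r | P i) F i).
Proof. by move=> IF; apply: big_ind => //; [exact: is_ideal0 | exact: is_idealD]. Qed.

Lemma is_ideal_congM f g f' g' : I (f - f') -> I (g - g') -> I (f * g - f' * g').
Proof.
move=> If Ig; rewrite (_ : _ - _ = (f - f') * g + f' * (g - g')); last by ring.
by apply: is_idealD; [exact: is_idealMr | exact: is_idealM].
Qed.

Lemma is_ideal_congX f f' n : I (f - f') -> I (f ^+ n - f' ^+ n).
Proof.
move=> If; elim: n => [|n IHn]; first by rewrite subrr; exact: is_ideal0.
by rewrite !exprS; exact: is_ideal_congM.
Qed.

Lemma ideal_gen_is_ideal (S : A -> Prop) : is_ideal (ideal_gen S).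
Proof. by split; [exact: ideal_gen0 | exact: ideal_genD | exact: ideal_genM]. Qed.

End IsIdeal.

(** * Syzygies of the twisted cubic *)

Section Syzygies.
Variables (R : idomainType) (x0 x1 x2 y : R).

Local Notation A := (x1 ^+ 2 - x0 * x2).
Local Notation B := (x1 * x2 - x0 * y).
Local Notation C := (x2 ^+ 2 - x1 * y).

Definition twisted_cubic (f : R) : Prop :=
  exists p q r, f = p * A + q * B + r * C.

(** All that the exactness proofs use about the four variables of a polynomial
    ring.  [reg_x1], [reg_x2] and [reg_y] say that x0, x1, x2, y is a regular
    sequence, [reg_C] that C and x1 A + x0 B form one, and the last three that
    variables are not zero divisors modulo the twisted cubic. *)
Record regular_variables : Prop := RegularVariables {
  reg_x0_neq0 : x0 != 0;
  reg_x1_neq0 : x1 != 0;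
  reg_C_neq0 : C != 0;
  reg_x1 : forall f g, x1 * f = x0 * g -> exists h, f = x0 * h;
  reg_x2 : forall f g0 g1, x2 * f = x0 * g0 + x1 * g1 ->
    exists h0 h1, f = x0 * h0 + x1 * h1;
  reg_y : forall f g0 g1 g2, y * f = x0 * g0 + x1 * g1 + x2 * g2 ->
    exists h0 h1 h2, f = x0 * h0 + x1 * h1 + x2 * h2;
  reg_C : forall f g, (x1 ^+ 3 - x0 ^+ 2 * y) * f = C * g ->
    exists h, f = C * h;
  cubic_x1 : forall f, twisted_cubic (x1 * f) -> twisted_cubic f;
  cubic_x2 : forall f, twisted_cubic (x2 * f) -> twisted_cubic f;
  cubic_y : forall f, twisted_cubic (y * f) -> twisted_cubic f }.

Hypothesis reg : regular_variables.

Lemma eq_of_sub (a b z : R) : a - b = z -> z = 0 -> a = b.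
Proof. by move=> <- /eqP; rewrite subr_eq0 => /eqP. Qed.

(** The first two rows of the Hilbert-Burch matrix have determinant C, so
    multiplying by their adjugate shows that C kills p and q. *)
Lemma cubic_second_syzygy p q :
  x2 * p - y * q = 0 -> x2 * q - x1 * p = 0 -> p = 0 /\ q = 0.
Proof.
move=> e1 e2; have nC := reg_C_neq0 reg.
split; apply: (mulfI nC).
  transitivity (x2 * (x2 * p - y * q) + y * (x2 * q - x1 * p)); first ring.
  by rewrite e1 e2 !mulr0 addr0.
transitivity (x1 * (x2 * p - y * q) + x2 * (x2 * q - x1 * p)); first ring.
by rewrite e1 e2 !mulr0 addr0.
Qed.

(** Exactness of the Hilbert-Burch complex in the middle.  By Cramer's rule, the
    2 x 2 minor on two given rows, times the syzygy, is a combination of the two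
    columns.  Dividing by C requires that C divides x2 a + y b and x1 a + x2 b,
    which follows from [reg_C] by comparing the minors A, B and C. *)
Lemma cubic_syzygy a b c : a * A + b * B + c * C = 0 ->
  exists p q, [/\ a = x2 * p - y * q, b = x2 * q - x1 * p & c = x0 * p - x1 * q].
Proof.
move=> e; have nC := reg_C_neq0 reg.
have [|p ep] := reg_C reg (f := x2 * a + y * b)
    (g := x0 * (x1 * a - y * c) - x1 * (x1 * b + x2 * c)).
  apply: (eq_of_sub (z := (x1 * x2 + x0 * y) * (a * A + b * B + c * C))).
    by ring.
  by rewrite e mulr0.
have [|q eq] := reg_C reg (f := x1 * a + x2 * b)
    (g := x0 * (x0 * a - x2 * c) - x1 * (x0 * b + x1 * c)).
  apply: (eq_of_sub (z := (x1 ^+ 2 + x0 * x2) * (a * A + b * B + c * C))).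
    by ring.
  by rewrite e mulr0.
exists p, q; split; apply: (mulfI nC).
- transitivity (x2 * (C * p) - y * (C * q)); last by ring.
  by rewrite -ep -eq; ring.
- transitivity (x2 * (C * q) - x1 * (C * p)); last by ring.
  by rewrite -ep -eq; ring.
- transitivity (x0 * (C * p) - x1 * (C * q)); last by ring.
  rewrite -ep -eq; apply: (eq_of_sub (z := a * A + b * B + c * C)) => //; ring.
Qed.

(** The dual of the Hilbert-Burch complex: the kernel of the transposed matrix
    is spanned by its maximal minors.  It provides phi3 when b = 2. *)
Lemma cubic_dual_syzygy u v w :
  y * w - x1 * u - x2 * v = 0 -> x0 * u + x1 * v - x2 * w = 0 ->
  exists l, [/\ u = - (C * l), v = B * l & w = A * l].
Proof.
move=> e1 e2; have nC := reg_C_neq0 reg.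
have eB : B * u = - (C * v).
  apply: (eq_of_sub (z := - (x2 * (y * w - x1 * u - x2 * v) +
    y * (x0 * u + x1 * v - x2 * w)))); first by ring.
  by rewrite e1 e2 !mulr0 addr0 oppr0.
have eA : A * u = - (C * w).
  apply: (eq_of_sub (z := - (x1 * (y * w - x1 * u - x2 * v) +
    x2 * (x0 * u + x1 * v - x2 * w)))); first by ring.
  by rewrite e1 e2 !mulr0 addr0 oppr0.
have [|l el] := reg_C reg (f := u) (g := - (x1 * w + x0 * v)).
  transitivity (x1 * (A * u) + x0 * (B * u)); first by ring.
  by rewrite eA eB; ring.
exists (- l); split; first by rewrite el; ring.
- apply: (mulfI nC); rewrite -[C * v]opprK -eB el; ring.
- apply: (mulfI nC); rewrite -[C * w]opprK -eA el; ring.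
Qed.

(** Lower part of phi2 when b = 1: three of the six columns are the Koszul
    relations of x1, x2, y, and the other three express - A, - B and - C.  The
    components are cleared in the order f, e, d: f is in (x0, x1, x2) since y is
    regular modulo this ideal, which contains T; then e is in (x0, x1, x2), because
    modulo (x0, x1) the relation becomes x2 e = x2^2 times something; finally
    d is in T since x1 is regular modulo T, and T e_1 is spanned by the columns. *)
Lemma cubic_x1x2y_syzygy d e f : twisted_cubic (x1 * d + x2 * e + y * f) ->
  exists p q r s t u,
    [/\ d = x2 * s + y * t - x1 * p - x2 * q,
        e = x0 * p + y * u - x2 * r - x1 * s
      & f = x0 * q + x1 * r - x1 * t - x2 * u].
Proof.
case=> [al [be [ga E]]].
have [|a [b [c ef]]] := reg_y reg (f := f)
    (g0 := - (al * x2 + be * y))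
    (g1 := al * x1 + be * x2 - ga * y - d) (g2 := ga * x2 - e).
  transitivity (x1 * d + x2 * e + y * f - (x1 * d + x2 * e)); first by ring.
  by rewrite E; ring.
have {}E : x1 * (d + x2 * a) + x2 * (e + x2 * b + y * c) =
    al * A + (be + a) * B + (ga + b) * C.
  transitivity (x1 * d + x2 * e + y * f + a * B + b * C); last by rewrite E; ring.
  by rewrite ef; ring.
have [|a' [b' ee]] := reg_x2 reg (f := e + x2 * b + y * c - (ga + b) * x2)
    (g0 := - (al * x2 + (be + a) * y))
    (g1 := al * x1 + (be + a) * x2 - (ga + b) * y - (d + x2 * a)).
  transitivity (x1 * (d + x2 * a) + x2 * (e + x2 * b + y * c) -
    x1 * (d + x2 * a) - (ga + b) * x2 ^+ 2); first by ring.
  by rewrite E; ring.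
have [|al2 [be2 [ga2 ed]]] := cubic_x1 reg
    (f := d + x2 * a + x1 * a' + x2 * b' + y * (ga + b)).
  exists (al + a'), (be + a), 0.
  transitivity (x1 * (d + x2 * a) + x2 * (e + x2 * b + y * c) + a' * A
    - (ga + b) * C - x2 * (e + x2 * b + y * c - (ga + b) * x2
    - (x0 * a' + x1 * b'))); first by ring.
  by rewrite E ee; ring.
exists (a' - al2 * x1), (a - be2 * x1), (- ga - ga2 * x1),
  (ga2 * x2 - b' - al2 * x0), (- ga - b - be2 * x0 - ga2 * x1), (- c).
split.
- apply: (eq_of_sub (z := (d + x2 * a + x1 * a' + x2 * b' + y * (ga + b)) -
    (al2 * A + be2 * B + ga2 * C))); first by ring.
  by rewrite ed subrr.
- apply: (eq_of_sub (z := e + x2 * b + y * c - (ga + b) * x2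
    - (x0 * a' + x1 * b'))); first by ring.
  by rewrite ee subrr.
- by rewrite ef; ring.
Qed.

(** Lower part of phi2 when b = 2, by the same elimination as
    [cubic_x1x2y_syzygy] with one component less. *)
Lemma cubic_x2y_syzygy d e : twisted_cubic (x2 * d + y * e) ->
  exists p q r, d = y * r - x1 * p - x2 * q /\ e = x0 * p + x1 * q - x2 * r.
Proof.
case=> [al [be [ga E]]].
have [|a [b [c ee]]] := reg_y reg (f := e)
    (g0 := - (al * x2 + be * y))
    (g1 := al * x1 + be * x2 - ga * y) (g2 := ga * x2 - d).
  transitivity (x2 * d + y * e - x2 * d); first by ring.
  by rewrite E; ring.
have [|al2 [be2 [ga2 ed]]] := cubic_x2 reg (f := d + x1 * a + x2 * b + y * c).
  exists al, (be + a), (ga + b).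
  transitivity (x2 * d + y * e + a * B + b * C); last by rewrite E; ring.
  by rewrite ee; ring.
exists (a - al2 * x1 - be2 * x2), (b + al2 * x0 - ga2 * x2),
  (- c - be2 * x0 - ga2 * x1); split.
- apply: (eq_of_sub (z := (d + x1 * a + x2 * b + y * c) -
    (al2 * A + be2 * B + ga2 * C))); first by ring.
  by rewrite ed subrr.
- by rewrite ee; ring.
Qed.

(** Lower part of phi3 when b = 1.  Regularity gives b and c from u, then a
    from r - t and q; once q and u are cleared, r and t agree and (s, t, 0) becomes a
    syzygy of (A, B, C), hence by [cubic_syzygy] a multiple of (B, -A, 0).  That
    multiple comes from the combination of the three columns with coefficients
    x2, x1, x0, whose entries q and u vanish. *)
Lemma cubic_x1x2y_second_syzygy p q r s t u :
  x2 * s + y * t - x1 * p - x2 * q = 0 ->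
  x0 * p + y * u - x2 * r - x1 * s = 0 ->
  x0 * q + x1 * r - x1 * t - x2 * u = 0 ->
  exists a b c,
    [/\ [/\ p = y * b - x2 * a, q = x1 * a - x2 * b & r = x1 * b - x0 * a],
        s = y * c - x2 * b, t = x1 * b - x2 * c & u = x1 * c - x0 * b].
Proof.
move=> e1 e2 e3; have n0 := reg_x0_neq0 reg; have n1 := reg_x1_neq0 reg.
have [|b [c eu]] := reg_x2 reg (f := u) (g0 := q) (g1 := r - t).
  apply: (eq_of_sub (z := - (x0 * q + x1 * r - x1 * t - x2 * u))).
    by ring.
  by rewrite e3 oppr0.
have [|h er] := reg_x1 reg (f := r - t - x2 * c) (g := x2 * b - q).
  apply: (eq_of_sub (z := (x0 * q + x1 * r - x1 * t - x2 * u) +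
    x2 * (u - (x0 * b + x1 * c)))); first by ring.
  by rewrite e3 eu subrr mulr0 addr0.
have {}er : r = t + x2 * c + x0 * h by rewrite -er; ring.
have eq : q = x2 * b - x1 * h.
  apply: (mulfI n0); apply: (eq_of_sub (z := x0 * q + x1 * r - x1 * t - x2 * u)) => //.
  by rewrite er eu; ring.
have [|p' [q' [eS eT e0]]] := @cubic_syzygy
    (s - (y * c + x2 * b)) (t - (- (x1 * b) - x2 * c)) 0.
  transitivity (- (x0 * (x2 * s + y * t - x1 * p - x2 * q) +
    x1 * (x0 * p + y * u - x2 * r - x1 * s))).
    by rewrite er eq eu; ring.
  by rewrite e1 e2 !mulr0 addr0 oppr0.
have [|l eq'] := reg_x1 reg (f := q') (g := p').
  by apply: (eq_of_sub (z := - (x0 * p' - x1 * q'))); [ring | rewrite -e0 oppr0].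
have ep' : p' = x1 * l.
  apply: (mulfI n0); apply: (eq_of_sub (z := x0 * p' - x1 * q')) => //.
  by rewrite eq'; ring.
have {}eS : s = y * c + x2 * b + B * l.
  apply: (eq_of_sub (z := s - (y * c + x2 * b) - B * l)); first by ring.
  by rewrite eS ep' eq'; ring.
have {}eT : t = - (x1 * b) - x2 * c - A * l.
  apply: (eq_of_sub (z := t - (- (x1 * b) - x2 * c) + A * l)); first by ring.
  by rewrite eT ep' eq'; ring.
exists (- h - x2 * l), (- b - x1 * l), (c - x0 * l).
split; [split| | |].
- apply: (mulfI n1).
  apply: (eq_of_sub (z := - (x2 * s + y * t - x1 * p - x2 * q))).
    by rewrite eS eT eq; ring.
  by rewrite e1 oppr0.
- by rewrite eq; ring.
- by rewrite er eT; ring.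
- by rewrite eS; ring.
- by rewrite eT; ring.
- by rewrite eu; ring.
Qed.

End Syzygies.

(** * Substitutions and regular variables *)

Section Substitution.
Variables (n : nat) (k : comNzRingType).

(** A substitution which moves each variable by an element of an ideal moves
    every polynomial by an element of that ideal. *)
Lemma mmap_cong (I : {mpoly k[n]} -> Prop) (h : 'I_n -> {mpoly k[n]}) f :
  is_ideal I -> (forall i, I ('X_i - h i)) -> I (f - mmap (@mpolyC n k) h f).
Proof.
move=> idI Ih; rewrite /mmap {1}[f]mpolyE -sumrB.
apply: is_ideal_sum => // m _; rewrite -mul_mpolyC -mulrBr; apply: is_idealM => //.
rewrite mpolyXE_id /mmap1.
apply: (big_ind2 (fun a b => I (a - b))).
- by rewrite subrr; exact: is_ideal0.
- by move=> f1 f2 g1 g2; exact: is_ideal_congM.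
- by move=> i _; exact: is_ideal_congX.
Qed.

End Substitution.

Section RegularSequence.
Variables (n : nat) (k : idomainType).

Definition kill (j : 'I_n) (f : {mpoly k[n]}) : {mpoly k[n]} :=
  mmap (@mpolyC n k) (fun i : 'I_n => if (i < j)%N then 0 else 'X_i) f.

HB.instance Definition _ j := GRing.RMorphism.copy (kill j)
  (mmap (@mpolyC n k) (fun i : 'I_n => if (i < j)%N then 0 else 'X_i)).

Lemma killX (j i : 'I_n) : kill j 'X_i = if (i < j)%N then 0 else 'X_i.
Proof. by rewrite /kill mmapX mmap1U. Qed.

Lemma mpolyX_neq0 m : 'X_[m] != 0 :> {mpoly k[n]}.
Proof. by apply/eqP => /(congr1 (mcoeff m))/eqP; rewrite mcoeffX eqxx mcoeff0 oner_eq0. Qed.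

(** The ideal (X_i : i < j) is the kernel of the substitution [kill j], which
    fixes 'X_j and has values in a domain. *)
Lemma kill_regular (I : {mpoly k[n]} -> Prop) (j : 'I_n) (f : {mpoly k[n]}) :
  is_ideal I -> (forall i : 'I_n, (i < j)%N -> I 'X_i) ->
  (forall g, I g -> kill j g = 0) -> I ('X_j * f) -> I f.
Proof.
move=> idI IX Ikill Ijf; have := Ikill _ Ijf.
rewrite rmorphM /= killX ltnn => /eqP.
rewrite mulf_eq0 (negPf (mpolyX_neq0 _)) /= => /eqP kf.
rewrite -[f]subr0 -kf; apply: mmap_cong => // i.
case: ifP => ij; first by rewrite subr0; exact: IX.
by rewrite subrr; exact: is_ideal0.
Qed.

End RegularSequence.

(** * Normal forms modulo the twisted cubic *)

Section NormalForm.
Variables (R : comNzRingType) (x0 x1 x2 y : R).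

(** The monomial of degree i and twist j with at most one factor among x1, x2.
    For j > 3 i, where there is none, the truncated exponent of x0 is 0. *)
Definition std_monomial (i j : nat) : R :=
  x0 ^+ (i - (j %/ 3 + (j %% 3 != 0)%N))%N * nth 0 [:: 1; x1; x2] (j %% 3)%N *
  y ^+ (j %/ 3)%N.

Variable I : R -> Prop.
Hypotheses (idI : is_ideal I) (IA : I (x1 ^+ 2 - x0 * x2))
  (IB : I (x1 * x2 - x0 * y)) (IC : I (x2 ^+ 2 - x1 * y)).

(** The quadrics replace x1^2 by x0 x2, x1 x2 by x0 y and x2^2 by x1 y.  This
    preserves degree and twist and lowers e1 + e2, so it ends with a monomial
    where e1 + e2 <= 1, which the remainder of the twist modulo 3 determines. *)
Lemma monomial_cong_std e0 e1 e2 e3 :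
  I (x0 ^+ e0 * x1 ^+ e1 * x2 ^+ e2 * y ^+ e3 -
     std_monomial (e0 + e1 + e2 + e3) (e1 + 2 * e2 + 3 * e3)).
Proof.
have [n] := ubnP (e1 + e2); elim: n e0 e1 e2 e3 => // n IHn e0 e1 e2 e3 le_n.
have [e1_gt1|e1_le1] := ltnP 1 e1.
  have := IHn e0.+1 (e1 - 2)%N e2.+1 e3 ltac:(lia).
  rewrite (_ : e0.+1 + _ + _ + _ = e0 + e1 + e2 + e3)%N; last by lia.
  rewrite (_ : e1 - 2 + _ + _ = e1 + 2 * e2 + 3 * e3)%N; last by lia.
  apply: is_ideal_trans => //.
  rewrite -{1}(subnK e1_gt1) exprD !exprS.
  rewrite (_ : _ - _ = x0 ^+ e0 * x1 ^+ (e1 - 2) * x2 ^+ e2 * y ^+ e3 *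
    (x1 ^+ 2 - x0 * x2)); last by ring.
  exact: is_idealM.
have [e2_gt1|e2_le1] := ltnP 1 e2.
  have := IHn e0 e1.+1 (e2 - 2)%N e3.+1 ltac:(lia).
  rewrite (_ : e0 + _ + _ + _ = e0 + e1 + e2 + e3)%N; last by lia.
  rewrite (_ : e1.+1 + _ + _ = e1 + 2 * e2 + 3 * e3)%N; last by lia.
  apply: is_ideal_trans => //.
  rewrite -{1}(subnK e2_gt1) exprD !exprS.
  rewrite (_ : _ - _ = x0 ^+ e0 * x1 ^+ e1 * x2 ^+ (e2 - 2) * y ^+ e3 *
    (x2 ^+ 2 - x1 * y)); last by ring.
  exact: is_idealM.
have [/andP[e1_gt0 e2_gt0]|small] := boolP ((0 < e1) && (0 < e2))%N.
  have := IHn e0.+1 e1.-1 e2.-1 e3.+1 ltac:(lia).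
  rewrite (_ : e0.+1 + _ + _ + _ = e0 + e1 + e2 + e3)%N; last by lia.
  rewrite (_ : e1.-1 + _ + _ = e1 + 2 * e2 + 3 * e3)%N; last by lia.
  apply: is_ideal_trans => //.
  rewrite -{1}(prednK e1_gt0) -{1}(prednK e2_gt0) !exprS.
  rewrite (_ : _ - _ = x0 ^+ e0 * x1 ^+ e1.-1 * x2 ^+ e2.-1 * y ^+ e3 *
    (x1 * x2 - x0 * y)); last by ring.
  exact: is_idealM.
have [q r] : ((e1 + 2 * e2 + 3 * e3) %/ 3 = e3 /\
    (e1 + 2 * e2 + 3 * e3) %% 3 = e1 + 2 * e2)%N.
  by lia.
rewrite /std_monomial q r.
have [[-> ->]|[[-> ->]|[-> ->]]] :
    (e1 = 0 /\ e2 = 0 \/ e1 = 1 /\ e2 = 0 \/ e1 = 0 /\ e2 = 1)%N by lia.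
all: rewrite (_ : (e0 + _ + _ + e3 - _)%N = e0); last by rewrite /=; lia.
all: rewrite [X in I X](_ : _ = 0); [exact: is_ideal0 | rewrite /=; ring].
Qed.

(** With j = 3 q + r, the bound on j says that q > a, or q = a and r >= b. *)
Lemma std_monomial_in a b i j :
  (b <= 3)%N -> I (y ^+ a.+1) ->
  (forall r, (b <= r < 3)%N -> I (nth 0 [:: 1; x1; x2] r * y ^+ a)) ->
  (3 * a + b <= j)%N -> I (std_monomial i j).
Proof.
move=> b3 Iy Ixy jab; rewrite /std_monomial -mulrA.
apply: is_idealM => //.
have [qa|qa] := ltnP a (j %/ 3)%N.
  rewrite -(subnK qa) exprD mulrA; exact: is_idealM.
by rewrite (_ : j %/ 3 = a)%N; [apply: Ixy | ]; lia.
Qed.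

End NormalForm.

(** * Evaluation on a monomial curve *)

Section Evaluation.
Variables (k : fieldType) (n : nat) (w : 'I_n -> nat).
Local Notation R := {mpoly k[n]}.
Local Notation A := (curve_ring k w).
Local Notation m_ := (@curve_max k n w).

Definition weight (m : 'X_{1..n}) : nat := (\sum_(j < n) m j * w j)%N.

Lemma weightD (m m' : 'X_{1..n}) : weight (m + m')%MM = (weight m + weight m')%N.
Proof. by rewrite /weight -big_split; apply: eq_bigr => j _; rewrite mnmDE mulnDl. Qed.

Lemma weightU j : weight U_(j)%MM = w j.
Proof.
rewrite /weight (bigD1 j) //= mnm1E eqxx mul1n big1 ?addn0 // => i /negPf ij.
by rewrite mnm1E eq_sym ij.
Qed.

Lemma weightMn (m : 'X_{1..n}) e : weight (m *+ e)%MM = (weight m * e)%N.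
Proof.
by rewrite /weight big_distrl; apply: eq_bigr => j _; rewrite mulmnE mulnAC.
Qed.

Lemma ps_monomM (b c : k) i j : ps_monom b i * ps_monom c j = ps_monom (b * c) (i + j).
Proof.
apply/funext => s; rewrite /GRing.mul /= /ps_mul /ps_monom.
under eq_bigr => l _ do rewrite mulrnAl mulrnAr -mulrnA.
have [->|si] := eqVneq s (i + j)%N.
  have li : (i < (i + j).+1)%N by lia.
  rewrite (bigD1 (Ordinal li)) //= eqxx addKn eqxx big1 ?addr0 // => l /eqP nl.
  rewrite [X in (_ * X)%N](_ : _ = 0%N) ?muln0 //.
  by case: eqP => // el; case: nl; apply: val_inj.
apply: big1 => l _; have := ltn_ord l.
move=> ls; rewrite (_ : ((_ == _) * (_ == _))%N = 0%N) //.
by case: eqP; case: eqP => //; lia.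
Qed.

Definition curve_eval (f : R) : A := mmap (@curve_const k n w) (@curve_gen k n w) f.

HB.instance Definition _ := GRing.RMorphism.copy curve_eval
  (mmap (@curve_const k n w) (@curve_gen k n w)).

Lemma curve_evalX m : curve_val (curve_eval 'X_[m]) = ps_monom 1 (weight m).
Proof.
rewrite /curve_eval mmapX /mmap1 /weight.
apply: (big_ind2 (fun (a : A) s => curve_val a = ps_monom 1 s)).
- exact/funext.
- by move=> a s b r ea eb; rewrite -[1]mulr1 -ps_monomM -ea -eb.
- move=> j _; elim: (m j) => [|e IHe]; first exact/funext.
  by rewrite exprS mulSn -[1]mulr1 -ps_monomM -IHe.
Qed.

Lemma curve_evalZX c m : curve_val (curve_eval (c *: 'X_[m])) = ps_monom c (weight m).
Proof.
rewrite /curve_eval mmapZ -/(curve_eval _) /=.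
by rewrite -[RHS]/(ps_monom _ (0 + _)) -[c in RHS]mulr1 -ps_monomM -curve_evalX.
Qed.

Lemma curve_evalE f s :
  curve_val (curve_eval f) s = \sum_(m <- msupp f | weight m == s) f@_m.
Proof.
rewrite {1}[f]mpolyE raddf_sum /=.
transitivity (\sum_(m <- msupp f) curve_val (curve_eval (f@_m *: 'X_[m])) s).
  elim: (msupp f) => [|m r IHr]; first by rewrite !big_nil.
  by rewrite !big_cons -IHr.
rewrite [RHS]big_mkcond; apply: eq_bigr => m _.
by rewrite curve_evalZX /ps_monom eq_sym; case: eqP.
Qed.

(** The vanishing ideal is defined by polynomials in t, whereas the filtration by
    powers of m lives on power series. *)
Lemma curve_idealP f : curve_ideal w f <-> curve_eval f = 0.
Proof.
have E s : (mmap (@polyC k) (fun j => 'X^(w j)) f)`_s = curve_val (curve_eval f) s.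
  rewrite curve_evalE /mmap coef_sum [RHS]big_mkcond; apply: eq_bigr => m _.
  rewrite coefCM /mmap1; under eq_bigr => j _ do rewrite -exprM mulnC.
  by rewrite prodrXr coefXn -/(weight m) eq_sym; case: eqP; rewrite ?mulr1 ?mulr0.
split=> [f0|f0].
  by apply/val_inj/funext => s; rewrite /= -E f0 coef0.
by apply/polyP => s; rewrite E f0 coef0.
Qed.

(** The condition on exponents implied by membership in m^i.  It does not
    mention coefficients, which makes it stable under sums and products. *)
Definition supp_ge i (x : A) : Prop :=
  forall s, curve_val x s != 0 ->
    exists2 m : 'X_{1..n}, weight m = s & (i <= mdeg m)%N.

Lemma supp_ge0 x : supp_ge 0 x.
Proof.
move=> s xs; have /curve_predP/(_ s xs)[e es] := valP x.
by exists [multinom e j | j < n]; rewrite // es; apply: eq_bigr => j _; rewrite mnmE.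
Qed.

Lemma supp_geD i x x' : supp_ge i x -> supp_ge i x' -> supp_ge i (x + x').
Proof.
move=> sx sx' s; rewrite (_ : curve_val (x + x') s = curve_val x s + curve_val x' s) //.
have [->|/sx //] := eqVneq (curve_val x s) 0; rewrite add0r; exact: sx'.
Qed.

Lemma supp_geM i j x x' : supp_ge i x -> supp_ge j x' -> supp_ge (i + j) (x * x').
Proof.
move=> sx sx' s; rewrite (_ : curve_val (x * x') s =
  \sum_(l < s.+1) curve_val x l * curve_val x' (s - l)%N) // => ns.
have [l] : exists l : 'I_s.+1, curve_val x l * curve_val x' (s - l)%N != 0.
  apply: contrapT => nex; case/eqP: ns; apply: big1 => l _.
  by apply/eqP; apply: contrapT => /negP nl; apply: nex; exists l.
rewrite mulf_eq0 negb_or => /andP[/sx[m1 w1 d1] /sx'[m2 w2 d2]].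
exists (m1 + m2)%MM; last by rewrite mdegD; exact: leq_add.
rewrite -[RHS](subnKC (leq_ord l)) -w2 -w1 -big_split /=.
by apply: eq_bigr => h _; rewrite mnmDE mulnDl.
Qed.

Lemma supp_ge_gen S i x : (forall z, S z -> supp_ge i z) -> ideal_gen S x -> supp_ge i x.
Proof.
move=> Si [r [Sr ->]]; rewrite big_seq; apply: big_ind.
- by move=> s; rewrite eqxx.
- exact: supp_geD.
- move=> q qr; rewrite -[i]add0n; apply: supp_geM; first exact: supp_ge0.
  exact/Si/Sr.
Qed.

Lemma supp_ge_pow i x : ideal_pow m_ i x -> supp_ge i x.
Proof.
apply: supp_ge_gen => _ [r [<- mr ->]].
elim: r mr => [|z r IHr] mr; first exact: supp_ge0.
rewrite big_cons -[size _]add1n; apply: supp_geM; last first.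
  by apply: IHr => z' zr; apply: mr; rewrite inE zr orbT.
have : m_ z by apply: mr; rewrite inE eqxx.
apply: supp_ge_gen => _ [j ->] s; rewrite /= /ps_monom.
have [-> _|] := eqVneq s (w j); last by rewrite mulr0n eqxx.
by exists U_(j)%MM; rewrite ?weightU ?mdeg1.
Qed.

Lemma curve_evalX_pow m : ideal_pow m_ (mdeg m) (curve_eval 'X_[m]).
Proof.
rewrite /curve_eval mmapX /mmap1 mdegE.
apply: (big_ind2 (fun (a : A) s => ideal_pow m_ s a)).
- exact: ideal_pow0.
- by move=> a s b r; exact: ideal_powM.
- move=> j _; elim: (m j) => [|e IHe]; first exact: ideal_pow0.
  rewrite exprS -add1n; apply: ideal_powM => //.
  by apply/ideal_pow1/ideal_gen_sub; exists j.
Qed.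

Lemma ideal_pow_anti i x : ideal_pow m_ i.+1 x -> ideal_pow m_ i x.
Proof.
move=> [s [Ss ->]]; apply: ideal_gen_sum => q qs; apply: ideal_genM.
have [[|z r] [//= [sr] mr ->]] := Ss q qs.
rewrite big_cons; apply: ideal_genM; apply: ideal_gen_sub; exists r; split=> //.
by move=> z' zr; apply: mr; rewrite inE zr orbT.
Qed.

Lemma ideal_pow_le i j x : (i <= j)%N -> ideal_pow m_ j x -> ideal_pow m_ i x.
Proof.
move=> /subnK <-; elim: (j - i)%N => // l IHl; rewrite addSn => /ideal_pow_anti; exact: IHl.
Qed.

(** The Rees algebra carries the degree in an extra variable, so its coefficient
    of index i sees the homogeneous component of degree i only. *)
Lemma rees_mmap_coef (f : R) i :
  (rees_val (mmap (@rees_const k n w) (@rees_gen k n w) f))`_i =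
  curve_eval (pihomog mdeg i f).
Proof.
rewrite {1}[f]mpolyE raddf_sum /= pihomogE raddf_sum /= [RHS]big_mkcond /=.
transitivity (\sum_(m <- msupp f)
   (rees_val (mmap (@rees_const k n w) (@rees_gen k n w) (f@_m *: 'X_[m])))`_i).
  elim: (msupp f) => [|m r IHr]; first by rewrite !big_nil rees_val0 coef0.
  by rewrite !big_cons -IHr -coefD.
apply: eq_bigr => m _; rewrite mmapZ mmapX rees_valM.
have -> : rees_val (mmap1 (@rees_gen k n w) m) = curve_eval 'X_[m] *: 'X^(mdeg m).
  rewrite /curve_eval mmapX mdegE /mmap1.
  apply: (big_ind3 (fun (p : rees m_) (a : A) s => rees_val p = a *: 'X^s)).
  - by rewrite rees_val1 scale1r.
  - move=> p a s q b r ep eq; rewrite rees_valM ep eq exprD.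
    by rewrite -!mul_polyC polyCM mulrACA.
  - move=> j _; elim: (m j) => [|e IHe]; first by rewrite rees_val1 scale1r.
    by rewrite !exprS rees_valM IHe /= -!mul_polyC polyCM mulrACA.
rewrite /= coefCM coefZ coefXn /curve_eval mmapZ eq_sym.
by case: eqP; rewrite ?mulr1 ?mulr0 //.
Qed.

Lemma tangent_map_eq0 (f : R) :
  tangent_map w f = 0 <-> forall i, ideal_pow m_ i.+1 (curve_eval (pihomog mdeg i f)).
Proof.
have -> : tangent_map w f = 0 <->
    mmap (@rees_const k n w) (@rees_gen k n w) f \in @rees_ideal A m_.
  rewrite /tangent_map -[0 in X in X <-> _](raddf0 (@gr_pi A m_)).
  by rewrite gr_piP subr0.
split=> [/rees_idealP fI i|fI]; first by rewrite -rees_mmap_coef.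
by apply/rees_idealP => i; rewrite rees_mmap_coef.
Qed.

(** * Surjectivity of the tangent map *)

Lemma ps_monom_shift i (g : pseries k) s :
  (ps_monom 1 i * g) s = if (i <= s)%N then g (s - i)%N else 0.
Proof.
rewrite /GRing.mul /= /ps_mul; case: leqP => [le_is|lt_si].
  have lis : (i < s.+1)%N by [].
  rewrite (bigD1 (Ordinal lis)) //= /ps_monom eqxx mul1r big1 ?addr0 // => l /eqP nl.
  by case: eqP => [el|_]; [case: nl; apply: val_inj | rewrite mul0r].
apply: big1 => l _; rewrite /ps_monom; case: eqP => [el|_]; last by rewrite mul0r.
by have := ltn_ord l; lia.
Qed.

Definition semigroup_step s : pred 'I_n :=
  fun j => (w j <= s)%N && `[< in_semigroup w (s - w j) >].

(** A nonzero element of the semigroup has a generator in one of its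
    decompositions, which can be subtracted. *)
Lemma semigroup_stepP s : (0 < s)%N -> in_semigroup w s -> exists j, semigroup_step s j.
Proof.
move=> s_gt0 [e es].
have [j ej] : exists j, (0 < e j)%N.
  apply: contrapT => nex; move: s_gt0; rewrite es big1 // => j _.
  by case: (posnP (e j)) => [->//|ej]; case: nex; exists j.
have wE : s = (w j + \sum_l (e l - (l == j)) * w l)%N.
  rewrite es (bigD1 j) //= [in RHS](bigD1 j) //= eqxx addnA; congr (_ + _)%N.
    by rewrite -[X in (X + _)%N]mul1n -mulnDl subnKC.
  by apply: eq_bigr => l /negPf ->; rewrite subn0.
exists j; apply/andP; split; first by rewrite wE leq_addr.
by apply/asboolP; exists (fun l => e l - (l == j))%N; rewrite {1}wE addKn.
Qed.

(** Each exponent s of x is assigned to one generator that can be subtracted from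
    s; this series collects the exponents assigned to the generator of index j,
    divided by it. *)
Definition quotient_series (x : A) (j : 'I_n) : pseries k := fun s =>
  if [pick l | semigroup_step (s + w j) l] == Some j then curve_val x (s + w j)%N else 0.

Lemma quotient_series_in x j : quotient_series x j \in curve_pred w.
Proof.
apply/curve_predP => s; rewrite /quotient_series.
case: pickP => [l /andP[_ /asboolP sl]|_]; last by rewrite eqxx.
by case: (Some l =P Some j) => [[lj]|_]; last (by rewrite eqxx); move: sl; rewrite lj addnK.
Qed.

Lemma curve_max_const0 (x : A) : curve_val x 0%N = 0 -> m_ x.
Proof.
move=> x0; rewrite (_ : x = \sum_j CurveRing (quotient_series_in x j) * curve_gen k w j).
  by apply: ideal_gen_sum => j _; apply/ideal_genM/ideal_gen_sub; exists j.
apply/val_inj/funext => s /=.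
transitivity (\sum_j (ps_monom 1 (w j) * quotient_series x j) s); last first.
  elim: (index_enum _) => [|j r IHr]; first by rewrite !big_nil.
  by rewrite !big_cons IHr mulrC.
transitivity (\sum_j if [pick l | semigroup_step s l] == Some j then curve_val x s else 0).
  case: pickP => [l sl|ns].
    by rewrite (bigD1 l) //= eqxx big1 ?addr0 // => j /negPf jl; case: eqP => // -[lj];
      rewrite lj eqxx in jl.
  rewrite big1 //; case: (posnP s) => [->//|s_gt0].
  apply/eqP; apply: contrapT => /negP xs.
  have /curve_predP/(_ s xs) := valP x => /(semigroup_stepP s_gt0)[j].
  by rewrite ns.
apply: eq_bigr => j _; rewrite ps_monom_shift /quotient_series.
case: leqP => ws; first by rewrite subnK.
case: pickP => [l sl|//]; case: eqP => // -[lj].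
by move: sl; rewrite lj /semigroup_step leqNgt ws.
Qed.

(** The residue field of the curve ring is k. *)
Lemma curve_const_max (x : A) : exists c, m_ (x - curve_const w c).
Proof.
exists (curve_val x 0%N); apply: curve_max_const0.
rewrite (_ : curve_val _ 0%N = curve_val x 0%N - ps_monom (curve_val x 0%N) 0 0%N) //.
by rewrite /ps_monom subrr.
Qed.

(** The classes of the monomials of degree i span m^i / m^(i+1) over k.  Products
    of i elements of m are treated by induction on i, a factor in m being a
    combination of generators; coefficients in the ring are replaced by their
    constant terms at the cost of an element of m^(i+1). *)
Lemma homog_approx i x : ideal_pow m_ i x ->
  exists2 f : R, f \is i.-homog & ideal_pow m_ i.+1 (x - curve_eval f).
Proof.
pose P i x := exists2 f : R, f \is i.-homog & ideal_pow m_ i.+1 (x - curve_eval f).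
have P0 l : P l 0 by exists 0; rewrite ?rpred0 // raddf0 subrr; exact: ideal_gen0.
have PD l z z' : P l z -> P l z' -> P l (z + z').
  move=> [f hf zf] [f' hf' zf']; exists (f + f'); first exact: rpredD.
  by rewrite raddfD opprD addrACA; exact: ideal_genD.
have PM l c z : ideal_pow m_ l z -> P l z -> P l (c * z).
  move=> mz [f hf zf]; have [c0 mc] := curve_const_max c.
  exists (c0 *: f); first exact: rpredZ.
  rewrite -mul_mpolyC rmorphM /=.
  rewrite [curve_eval c0%:MP](mmapC (@curve_gen k n w) (@curve_const k n w)) /=.
  rewrite (_ : _ - _ = curve_const w c0 * (z - curve_eval f) + (c - curve_const w c0) * z);
    last by ring.
  apply: ideal_genD; first exact: ideal_genM.
  by rewrite -add1n; apply: ideal_powM => //; exact: ideal_pow1.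
suff Pprod (r : seq A) : (forall z, z \in r -> m_ z) ->
    ideal_pow m_ (size r) (\prod_(z <- r) z) /\ P (size r) (\prod_(z <- r) z).
  move=> [s [Ss ->]]; rewrite big_seq; apply: (big_ind (P i)); [exact: P0 | exact: PD | ].
  move=> q qs; have [r [<- mr ->]] := Ss q qs; have [? ?] := Pprod r mr.
  exact: PM.
elim: r => [|z r IHr] mr.
  split; first exact: ideal_pow0.
  rewrite big_nil; exists 1; first by rewrite dhomog1.
  by rewrite rmorph1 subrr; exact: ideal_gen0.
have [mp Pp] := IHr (fun z' z'r => mr z' ltac:(by rewrite inE z'r orbT)).
have mz : m_ z by apply: mr; rewrite inE eqxx.
rewrite big_cons /=; split; first by rewrite -add1n; apply: ideal_powM => //; exact: ideal_pow1.
case: mz => s [Ss ->]; rewrite big_seq mulr_suml.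
apply: (big_ind (P (size r).+1)); [exact: P0 | exact: PD | ].
move=> q qs; have [j ->] := Ss q qs; rewrite -mulrA.
have mj : m_ (curve_gen k w j) by apply: ideal_gen_sub; exists j.
apply: PM; first by rewrite -add1n; apply: ideal_powM => //; exact: ideal_pow1.
have [f hf pf] := Pp; exists ('X_j * f).
  by rewrite -add1n; apply: dhomogM => //; rewrite dhomogX /= mdeg1.
rewrite rmorphM /= {1}/curve_eval mmapX mmap1U -mulrBr -add1n.
by apply: ideal_powM => //; exact: ideal_pow1.
Qed.

(** An element of the Rees algebra has finitely many coefficients, and each of
    them is approximated by a homogeneous polynomial. *)
Lemma tangent_map_surj (g : tangent_ring k w) : exists f, tangent_map w f = g.
Proof.
have [p <-] := gr_pi_surj g.
have /choice[F HF] : forall i, exists f : R,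
    f \is i.-homog /\ ideal_pow m_ i.+1 ((rees_val p)`_i - curve_eval f).
  by move=> i; have [f hf xf] := homog_approx (rees_valP p i); exists f.
exists (\sum_(i < size (rees_val p)) F i); apply/esym/gr_piP/rees_idealP => i.
rewrite rees_valB coefB rees_mmap_coef.
have [lt_i|le_i] := ltnP i (size (rees_val p)).
  suff -> : pihomog mdeg i (\sum_(j < size (rees_val p)) F j) = F i by exact: (HF i).2.
  rewrite raddf_sum /= (bigD1 (Ordinal lt_i)) //= (pihomog_dE (HF i).1).
  rewrite big1 ?addr0 // => j /negPf ji; apply: pihomog_ne0 (HF j).1.
  by rewrite -[i]/(val (Ordinal lt_i)) (inj_eq val_inj) ji.
suff -> : pihomog mdeg i (\sum_(j < size (rees_val p)) F j) = 0.
  by rewrite nth_default // raddf0 subrr; exact: ideal_gen0.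
rewrite raddf_sum big1 // => j _; apply: pihomog_ne0 (HF j).1.
by rewrite ltn_eqF // (leq_trans (ltn_ord j)).
Qed.

(** * Initial forms and the kernel of the tangent map *)

Lemma mpoly_order_le (f : R) m : m \in msupp f -> (mpoly_order f <= mdeg m)%N.
Proof.
rewrite /mpoly_order; elim: (msupp f) => // m' r IHr.
rewrite inE big_cons geq_min => /orP[/eqP <-|/IHr ->]; first by rewrite leqnn.
by rewrite orbT.
Qed.

Lemma mpoly_order_ge (f : R) d : f != 0 ->
  (forall m, m \in msupp f -> (d <= mdeg m)%N) -> (d <= mpoly_order f)%N.
Proof.
move=> f0 fd; rewrite /mpoly_order big_seq; apply: (big_ind (fun e => d <= e)%N) => //.
- apply: (leq_trans (fd _ (mlead_supp f0))).
  by apply/ltnW/msize_mdeg_lt/mlead_supp.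
- by move=> a b da db; rewrite leq_min da.
Qed.

(** As f vanishes on the curve, its initial form takes the same value as the
    opposite of the sum of its terms of larger degree. *)
Lemma tangent_map_initial_form (f : R) :
  curve_ideal w f -> tangent_map w (initial_form f) = 0.
Proof.
move=> /curve_idealP f0; apply/tangent_map_eq0 => i; rewrite /initial_form.
set o := mpoly_order f.
have [->|oi] := eqVneq i o; last first.
  rewrite (pihomog_ne0 _ (pihomogP mdeg o f)) 1?eq_sym // raddf0; exact: ideal_gen0.
rewrite pihomog_id -[X in ideal_pow _ _ X]opprK; apply: ideal_genN.
rewrite -[X in ideal_gen _ X]add0r -f0 -raddfB pihomogE {1}[f]mpolyE.
rewrite (bigID (fun m => mdeg m == o)) /= addrAC subrr add0r raddf_sum big_seq_cond /=.
apply: (is_ideal_sum (ideal_gen_is_ideal _)) => m /andP[mf mo].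
rewrite -mul_mpolyC rmorphM /=; apply: ideal_genM.
apply: ideal_pow_le (curve_evalX_pow m).
by rewrite ltn_neqAle eq_sym mo mpoly_order_le.
Qed.

Lemma tangent_map_tangent_cone (f : R) :
  tangent_cone_ideal w f -> tangent_map w f = 0.
Proof.
move=> [s [Ss ->]]; rewrite raddf_sum /= big_seq big1 // => q qs.
have [g [_ gI eg]] := Ss q qs.
by rewrite rmorphM /= eg tangent_map_initial_form // mulr0.
Qed.

(** The initial form of a binomial that vanishes on the curve: the binomial
    itself if it is homogeneous, and its term of smaller degree otherwise. *)
Lemma tangent_cone_binomial (m m' : 'X_{1..n}) :
  m != m' -> weight m = weight m' -> (mdeg m <= mdeg m')%N ->
  tangent_cone_ideal w ('X_[k, m] - (if mdeg m' == mdeg m then 'X_[m'] else 0)).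
Proof.
move=> mm' ww dd; set f : R := 'X_[m] - 'X_[m'].
have fm : m \in msupp f.
  by rewrite mcoeff_msupp mcoeffB !mcoeffX eqxx [m' == m]eq_sym (negPf mm') subr0 oner_eq0.
have f0 : f != 0 by apply/eqP => f0; move: fm; rewrite f0 msupp0.
apply: ideal_gen_sub; exists f; split=> //.
  apply/curve_idealP/val_inj; rewrite raddfB /=.
  by rewrite -[LHS]/(curve_val _ - curve_val _) !curve_evalX ww subrr.
rewrite /initial_form (_ : mpoly_order f = mdeg m).
  by rewrite raddfB /= !pihomogX eqxx.
apply/eqP; rewrite eqn_leq mpoly_order_le //=; apply: mpoly_order_ge => // l.
by move=> /msuppB_le; rewrite mem_cat !msuppX !inE => /orP[]/eqP ->.
Qed.

(** The sum is the coefficient of t^s in the value of the component of degree i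
    of f.  This value is in m^(i+1), where the exponent s does not occur. *)
Lemma tangent_map_kernel_coef (f : R) i s : tangent_map w f = 0 ->
  (forall m : 'X_{1..n}, weight m = s -> (mdeg m <= i)%N) ->
  \sum_(m <- msupp f | (mdeg m == i) && (weight m == s)) f@_m = 0.
Proof.
move=> /tangent_map_eq0/(_ i)/supp_ge_pow/(_ s) fs small.
rewrite (_ : \sum_(m <- _ | _) _ = curve_val (curve_eval (pihomog mdeg i f)) s).
  apply/eqP; apply: contrapT => /negP/fs[m ws dm].
  by have := small m ws; rewrite leqNgt dm.
rewrite pihomogE raddf_sum /=.
transitivity (\sum_(m <- msupp f | mdeg m == i)
    curve_val (curve_eval (f@_m *: 'X_[m])) s); last first.
  elim: (msupp f) => [|m r IHr]; first by rewrite !big_nil.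
  by rewrite !big_cons IHr; case: ifP.
rewrite [LHS]big_mkcondr /=; apply: eq_bigr => m _.
by rewrite curve_evalZX /ps_monom eq_sym; case: eqP.
Qed.

End Evaluation.

Section FourVariables.
Variable k : fieldType.
Local Notation R := {mpoly k[4]}.
Local Notation x0 := 'X_[k, U_(@Ordinal 4 0 isT)].
Local Notation x1 := 'X_[k, U_(@Ordinal 4 1 isT)].
Local Notation x2 := 'X_[k, U_(@Ordinal 4 2 isT)].
Local Notation y := 'X_[k, U_(@Ordinal 4 3 isT)].

(** * Regular sequences in four variables *)

Lemma mpoly_reg_x1 (f g : R) : x1 * f = x0 * g -> exists h, f = x0 * h.
Proof.
move=> e; apply: (@kill_regular 4 k (fun f => exists h, f = x0 * h) (@Ordinal 4 1 isT)).
- split; first by exists 0; rewrite mulr0.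
    by move=> _ _ [h ->] [h' ->]; exists (h + h'); rewrite mulrDr.
  by move=> c _ [h ->]; exists (c * h); rewrite mulrCA.
- case=> -[|//] /= lt _; exists 1; rewrite mulr1; congr ('X_ _); exact: val_inj.
- by move=> _ [h ->]; rewrite rmorphM /= killX mul0r.
- by exists g.
Qed.

Lemma mpoly_reg_x2 (f g0 g1 : R) : x2 * f = x0 * g0 + x1 * g1 ->
  exists h0 h1, f = x0 * h0 + x1 * h1.
Proof.
move=> e; apply: (@kill_regular 4 k
  (fun f => exists h0 h1, f = x0 * h0 + x1 * h1) (@Ordinal 4 2 isT)).
- split; first by exists 0, 0; rewrite !mulr0 addr0.
    by move=> _ _ [h0 [h1 ->]] [h0' [h1' ->]]; exists (h0 + h0'), (h1 + h1'); ring.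
  by move=> c _ [h0 [h1 ->]]; exists (c * h0), (c * h1); ring.
- case=> -[|[|//]] /= lt _; [exists 1, 0 | exists 0, 1];
    rewrite mulr1 mulr0 ?addr0 ?add0r; congr ('X_ _); exact: val_inj.
- move=> _ [h0 [h1 ->]]; rewrite rmorphD !rmorphM /= !killX /=.
  by rewrite !mul0r addr0.
- by exists g0, g1.
Qed.

Lemma mpoly_reg_y (f g0 g1 g2 : R) : y * f = x0 * g0 + x1 * g1 + x2 * g2 ->
  exists h0 h1 h2, f = x0 * h0 + x1 * h1 + x2 * h2.
Proof.
move=> e; apply: (@kill_regular 4 k
  (fun f => exists h0 h1 h2, f = x0 * h0 + x1 * h1 + x2 * h2) (@Ordinal 4 3 isT)).
- split; first by exists 0, 0, 0; rewrite !mulr0 !addr0.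
    move=> _ _ [h0 [h1 [h2 ->]]] [h0' [h1' [h2' ->]]].
    by exists (h0 + h0'), (h1 + h1'), (h2 + h2'); ring.
  by move=> c _ [h0 [h1 [h2 ->]]]; exists (c * h0), (c * h1), (c * h2); ring.
- case=> -[|[|[|//]]] /= lt _; [exists 1, 0, 0 | exists 0, 1, 0 | exists 0, 0, 1];
    rewrite mulr1 !mulr0 ?addr0 ?add0r; congr ('X_ _); exact: val_inj.
- move=> _ [h0 [h1 [h2 ->]]].
  rewrite !rmorphD !rmorphM /= !killX /=.
  by rewrite !mul0r !addr0.
- by exists g0, g1, g2.
Qed.

(** A polynomial read as a polynomial in x2 whose coefficients happen not to
    involve x2.  Keeping them in R avoids a polynomial ring in three variables. *)
Definition poly_x2 (f : R) : {poly R} :=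
  mmap (polyC \o @mpolyC 4 k) (fun i : 'I_4 => if i == 2%N :> nat then 'X else ('X_i)%:P) f.

HB.instance Definition _ := GRing.RMorphism.copy poly_x2
  (mmap (polyC \o @mpolyC 4 k) (fun i : 'I_4 => if i == 2%N :> nat then 'X else ('X_i)%:P)).

Lemma poly_x2X i : poly_x2 'X_i = if i == 2%N :> nat then 'X else ('X_i)%:P.
Proof. by rewrite /poly_x2 mmapX mmap1U. Qed.

Lemma poly_x2K f : (poly_x2 f).[x2] = f.
Proof.
rewrite /poly_x2 /mmap horner_sum [RHS]mpolyE; apply: eq_bigr => m _.
rewrite hornerM hornerC -mul_mpolyC [in RHS]mpolyXE_id; congr (_ * _).
rewrite /mmap1 horner_prod; apply: eq_bigr => i _; rewrite horner_exp.
by case: eqP => [i2|_]; rewrite ?hornerX ?hornerC //; congr ('X_ _ ^+ _); exact: val_inj.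
Qed.

(** C is monic in x2 and c = x1^3 - x0^2 y does not involve x2.  If C divides c f,
    then it divides c r where r is the remainder of f, and c r has degree < 2 in
    x2; so c r = 0. *)
Lemma mpoly_reg_C (f g : R) : (x1 ^+ 3 - x0 ^+ 2 * y) * f = (x2 ^+ 2 - x1 * y) * g ->
  exists h, f = (x2 ^+ 2 - x1 * y) * h.
Proof.
move=> e; pose c : R := x1 ^+ 3 - x0 ^+ 2 * y; pose D : {poly R} := 'X^2 - (x1 * y)%:P.
set f' := poly_x2 f; set g' := poly_x2 g.
have E : c%:P * f' = D * g'.
  have -> : c%:P = poly_x2 c.
    rewrite /c polyCB polyC_exp polyCM polyC_exp [RHS]rmorphB rmorphXn [in RHS]rmorphM /=.
    by rewrite [in RHS]rmorphXn /= !poly_x2X.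
  have -> : D = poly_x2 (x2 ^+ 2 - x1 * y).
    by rewrite /D polyCM rmorphB rmorphXn /= rmorphM /= !poly_x2X.
  have := congr1 poly_x2 e; rewrite rmorphM [RHS]rmorphM /=; exact.
have sD : size D = 3%N by rewrite size_XnsubC.
have mD : D \is monic by rewrite monicXnsubC.
have c0 : c != 0.
  apply/eqP => /(congr1 (mcoeff (U_(@Ordinal 4 1 isT) *+ 3)%MM))/eqP.
  rewrite mcoeffB mcoeff0 mpolyXn mcoeffX eqxx mpolyXn -mpolyXD mcoeffX.
  case: (eqVneq (_ + _)%MM _) => [e1|_]; last by rewrite subr0 oner_eq0.
  by have := (mnmP _ _).1 e1 (@Ordinal 4 0 isT); rewrite mnmDE !mulmnE !mnm1E.
have fE := Pdiv.RingMonic.rdivp_eq mD f'.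
have sr := Pdiv.Ring.ltn_rmodpN0 f' (monic_neq0 mD).
move: fE sr; set q := Pdiv.Ring.rdivp _ _; set r := Pdiv.Ring.rmodp _ _ => fE sr.
have Er : c%:P * r = D * (g' - c%:P * q).
  by rewrite mulrBr -E fE; ring.
have r0 : r = 0.
  apply/eqP; case: (eqVneq (g' - c%:P * q) 0) => [g0|g0].
    by move: Er; rewrite g0 mulr0 => /eqP; rewrite mulf_eq0 polyC_eq0 (negPf c0).
  have := size_monicM mD g0; rewrite -Er mul_polyC => ss.
  have := leq_ltn_trans (size_scale_leq c r) sr.
  by have := g0; rewrite -size_poly_gt0 ss sD; lia.
exists q.[x2]; rewrite -[LHS]poly_x2K -/f' fE r0 addr0 hornerM mulrC.
by rewrite /D hornerD hornerN hornerXn hornerC.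
Qed.

(** * The twisted cubic is a prime ideal *)

Definition twist (m : 'X_{1..4}) : nat := (\sum_(j < 4) m j * j)%N.

(** The coefficient of the normal monomial of degree i and twist j in f modulo
    the twisted cubic. *)
Definition bicoef (f : R) (i j : nat) : k :=
  \sum_(m <- msupp f | (mdeg m == i) && (twist m == j)) f@_m.

Lemma big_ord4 (T : Type) (idx : T) (op : Monoid.law idx) (F : 'I_4 -> T) :
  \big[op/idx]_(j < 4) F j = op (op (op (F (@Ordinal 4 0 isT)) (F (@Ordinal 4 1 isT)))
    (F (@Ordinal 4 2 isT))) (F (@Ordinal 4 3 isT)).
Proof.
rewrite !big_ord_recr big_ord0 /= Monoid.mul1m.
by do ![congr (op _ _)]; congr F; exact: val_inj.
Qed.

Lemma mpolyX_exp4 (m : 'X_{1..4}) : 'X_[k, m] =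
  x0 ^+ m (@Ordinal 4 0 isT) * x1 ^+ m (@Ordinal 4 1 isT) *
  x2 ^+ m (@Ordinal 4 2 isT) * y ^+ m (@Ordinal 4 3 isT).
Proof. by rewrite mpolyXE_id big_ord4. Qed.

Lemma mdeg4 (m : 'X_{1..4}) : mdeg m =
  (m (@Ordinal 4 0 isT) + m (@Ordinal 4 1 isT) + m (@Ordinal 4 2 isT) + m (@Ordinal 4 3 isT))%N.
Proof. by rewrite mdegE big_ord4. Qed.

Lemma twist4 (m : 'X_{1..4}) : twist m =
  (m (@Ordinal 4 1 isT) + 2 * m (@Ordinal 4 2 isT) + 3 * m (@Ordinal 4 3 isT))%N.
Proof. by rewrite /twist big_ord4 /= muln0 muln1 !(mulnC (m _)). Qed.

Section Ideal.
Variable I : R -> Prop.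
Hypotheses (idI : is_ideal I) (IA : I (x1 ^+ 2 - x0 * x2))
  (IB : I (x1 * x2 - x0 * y)) (IC : I (x2 ^+ 2 - x1 * y)).

Local Notation std := (std_monomial x0 x1 x2 y).

Lemma mpolyX_cong_std m : I ('X_[m] - std (mdeg m) (twist m)).
Proof. by rewrite (mpolyX_exp4 m) mdeg4 twist4; exact: (monomial_cong_std idI IA IB IC). Qed.

(** Modulo I, f is the sum of its coefficients [bicoef f i j] times the normal
    monomials of degree i and twist j. *)
Lemma in_ideal_bicoef f :
  (forall i j, bicoef f i j = 0 \/ I (std i j)) -> I f.
Proof.
move=> If; pose b := msize f.
rewrite -(subrK (\sum_(m <- msupp f) f@_m *: std (mdeg m) (twist m)) f).
apply: is_idealD => //.
  rewrite {1}[f]mpolyE -sumrB; apply: is_ideal_sum => // m _.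
  rewrite -scalerBr -mul_mpolyC; apply: is_idealM => //; exact: mpolyX_cong_std.
pose N := (\max_(m <- msupp f) twist m).+1.
have -> : \sum_(m <- msupp f) f@_m *: std (mdeg m) (twist m) =
    \sum_(i < b) \sum_(j < N) bicoef f i j *: std i j.
  under [RHS]eq_bigr => i _ do under eq_bigr => j _ do
    rewrite /bicoef scaler_suml big_mkcond.
  under [RHS]eq_bigr => i _ do rewrite exchange_big.
  rewrite exchange_big; apply: eq_big_seq => m mf /=.
  have mb : (mdeg m < b)%N by exact: msize_mdeg_lt.
  have mN : (twist m < N)%N by rewrite ltnS; exact: (@leq_bigmax_seq _ _ xpredT).
  rewrite (bigD1 (Ordinal mb)) //= [X in _ + X]big1 ?addr0; last first.
    move=> i /negPf ni; apply: big1 => j _; rewrite -/(mdeg m).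
    by rewrite -[mdeg m](erefl (val (Ordinal mb))) (inj_eq val_inj) eq_sym ni.
  rewrite (bigD1 (Ordinal mN)) //= !eqxx /= [X in _ + X]big1 ?addr0 //.
  by move=> j /negPf nj; rewrite -[twist m](erefl (val (Ordinal mN))) (inj_eq val_inj) eq_sym nj.
apply: is_ideal_sum => // i _; apply: is_ideal_sum => // j _.
have [->|Is] := If i j; first by rewrite scale0r; exact: is_ideal0.
by rewrite -mul_mpolyC; exact: is_idealM.
Qed.

End Ideal.

(** The parametrization x_j = s z^j of the cone over the twisted cubic; s is the
    outer variable and z the inner one. *)
Definition bigraded (f : R) : {poly {poly k}} :=
  mmap (polyC \o polyC) (fun j : 'I_4 => ('X^j)%:P * 'X) f.

HB.instance Definition _ := GRing.RMorphism.copy bigraded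
  (mmap (polyC \o polyC : k -> {poly {poly k}}) (fun j : 'I_4 => ('X^j)%:P * 'X)).

Lemma bigradedX j : bigraded 'X_j = ('X^j)%:P * 'X.
Proof. by rewrite /bigraded mmapX mmap1U. Qed.

Lemma bigraded_coef f i j : (bigraded f)`_i`_j = bicoef f i j.
Proof.
rewrite /bigraded /mmap coef_sum coef_sum /bicoef [RHS]big_mkcond.
apply: eq_bigr => m _ /=; rewrite coefCM coefCM /mmap1.
under eq_bigr => l _ do rewrite exprMn -rmorphXn -exprM mulnC.
rewrite big_split /= -rmorph_prod prodrXr prodrXr -mdegE.
rewrite coefCM coefXn -/(twist m).
rewrite [i == _]eq_sym; case: eqP => _ /=; last by rewrite mulr0 coef0 mulr0.
by rewrite mulr1 coefXn eq_sym; case: eqP; rewrite ?mulr1 ?mulr0.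
Qed.

Lemma twisted_cubicP f : twisted_cubic x0 x1 x2 y f <-> bigraded f = 0.
Proof.
split=> [[p [q [r ->]]]|f0].
  have bA : bigraded (x1 ^+ 2 - x0 * x2) = 0.
    by rewrite rmorphB rmorphXn rmorphM /= !bigradedX /=; ring.
  have bB : bigraded (x1 * x2 - x0 * y) = 0.
    by rewrite rmorphB !rmorphM /= !bigradedX /=; ring.
  have bC : bigraded (x2 ^+ 2 - x1 * y) = 0.
    by rewrite rmorphB rmorphXn rmorphM /= !bigradedX /=; ring.
  by rewrite !rmorphD !rmorphM /= bA bB bC !mulr0 !addr0.
have idT : is_ideal (twisted_cubic x0 x1 x2 y).
  split; first by exists 0, 0, 0; rewrite !mul0r !addr0.
    move=> _ _ [p [q [r ->]]] [p' [q' [r' ->]]].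
    by exists (p + p'), (q + q'), (r + r'); ring.
  by move=> c _ [p [q [r ->]]]; exists (c * p), (c * q), (c * r); ring.
apply: (in_ideal_bicoef idT) => [|||i j].
- by exists 1, 0, 0; ring.
- by exists 0, 1, 0; ring.
- by exists 0, 0, 1; ring.
by left; rewrite -bigraded_coef f0 !coef0.
Qed.

(** The twisted cubic is the kernel of a morphism to a domain that kills no
    variable. *)
Lemma twisted_cubic_regular j f :
  twisted_cubic x0 x1 x2 y ('X_j * f) -> twisted_cubic x0 x1 x2 y f.
Proof.
rewrite !twisted_cubicP rmorphM /= bigradedX => /eqP.
rewrite !mulf_eq0 polyC_eq0 polyX_eq0 expf_eq0 polyX_eq0 andbF /=.
by move/eqP.
Qed.

Lemma mpoly_regular_variables : regular_variables x0 x1 x2 y.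
Proof.
split; try exact: mpolyX_neq0; try exact: twisted_cubic_regular.
- apply/eqP => /(congr1 (mcoeff (U_(@Ordinal 4 2 isT) *+ 2)%MM))/eqP.
  rewrite mcoeffB mcoeff0 mpolyXn mcoeffX eqxx -mpolyXD mcoeffX.
  case: (eqVneq (_ + _)%MM _) => [e1|_]; last by rewrite subr0 oner_eq0.
  by have := (mnmP _ _).1 e1 (@Ordinal 4 1 isT); rewrite mnmDE !mulmnE !mnm1E.
- exact: mpoly_reg_x1.
- exact: mpoly_reg_x2.
- exact: mpoly_reg_y.
- exact: mpoly_reg_C.
Qed.

(** * Weights in arithmetic progression *)

Section Arithmetic.
Variables a b d : nat.
Local Notation w := (arith_weight a b d).
Local Notation TC := (@tangent_cone_ideal k 4 w).

Lemma weight_arith m : weight w m = (mdeg m * (3 * a + b) + twist m * d)%N.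
Proof.
rewrite /weight /arith_weight mdegE /twist !big_distrl -big_split /=.
by apply: eq_bigr => j _; rewrite mulnDr mulnA.
Qed.

(** Let m have degree i' > i and twist j'.  Then (i' - i) m0 = (j - j') d, and m0
    divides j - j', which lies strictly between 0 and m0. *)
Lemma weight_bound i j m : coprime (3 * a + b) d -> (j < 3 * a + b)%N ->
  weight w m = (i * (3 * a + b) + j * d)%N -> (mdeg m <= i)%N.
Proof.
rewrite weight_arith => cop lt_j e; rewrite leqNgt; apply/negP => lt_i.
have e' : ((mdeg m - i) * (3 * a + b) = (j - twist m) * d)%N.
  by rewrite !mulnBl; lia.
have : (3 * a + b %| j - twist m)%N.
  by rewrite -(Gauss_dvdl _ cop) -e' dvdn_mull.
have lt_twist : (0 < j - twist m)%N.
  have : (0 < (mdeg m - i) * (3 * a + b))%N by rewrite muln_gt0; lia.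
  by rewrite e' muln_gt0 => /andP[].
by move=> /(dvdn_leq lt_twist); lia.
Qed.

(** In degree i, the weight i m0 + j d selects the monomials of twist j. *)
Lemma kernel_bicoef (f : R) i j :
  (0 < d)%N -> coprime (3 * a + b) d -> tangent_map w f = 0 ->
  (j < 3 * a + b)%N -> bicoef f i j = 0.
Proof.
move=> d_gt0 cop f0 lt_j.
have := tangent_map_kernel_coef f0 (fun m => @weight_bound i j m cop lt_j).
move=> <-; apply: eq_bigl => m; case: eqP => //= mi.
rewrite weight_arith mi; apply/eqP/eqP => [-> //|/eqP].
by rewrite eqn_add2l eqn_pmul2r // => /eqP.
Qed.

Lemma tangent_kernel_sub (I : R -> Prop) f :
  (0 < d)%N -> coprime (3 * a + b) d -> (b <= 3)%N -> is_ideal I ->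
  I (x1 ^+ 2 - x0 * x2) -> I (x1 * x2 - x0 * y) -> I (x2 ^+ 2 - x1 * y) ->
  I (y ^+ a.+1) -> (forall r, (b <= r < 3)%N -> I (nth 0 [:: 1; x1; x2] r * y ^+ a)) ->
  tangent_map w f = 0 -> I f.
Proof.
move=> d_gt0 cop b_le3 idI IA IB IC Iy Ixy f0; apply: in_ideal_bicoef => // i j.
have [lt_j|le_j] := ltnP j (3 * a + b); first by left; exact: kernel_bicoef.
by right; exact: (std_monomial_in _ idI _ b_le3 Iy).
Qed.

Lemma tangent_cone_quadric (i j l h : 'I_4) :
  (i + j = l + h)%N -> (i != l) && (i != h) -> TC ('X_i * 'X_j - 'X_l * 'X_h).
Proof.
move=> e /andP[il ih]; rewrite -!mpolyXD.
have := @tangent_cone_binomial k 4 w (U_(i) + U_(j))%MM (U_(l) + U_(h))%MM.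
rewrite !mdegD !mdeg1 eqxx; apply=> //.
  apply/eqP => /mnmP/(_ i); rewrite !mnmDE !mnm1E eqxx.
  by rewrite ![_ == i]eq_sym (negPf il) (negPf ih).
by rewrite !weightD !weightU /arith_weight addnACA [RHS]addnACA -!mulnDl e.
Qed.

(** With i = j + b, the weights of x_i y^a and x_j x0^(a+d) are
    (a + 1) m0 + (3a + i) d and (a + d + 1) m0 + j d.  They agree because
    (3a + b) d = m0 d. *)
Lemma tangent_cone_power (i j : 'I_4) :
  (0 < d)%N -> (i = j + b :> nat)%N -> TC ('X_i * 'X_(@Ordinal 4 3 isT) ^+ a).
Proof.
move=> d_gt0 e; rewrite mpolyXn -mpolyXD.
have := @tangent_cone_binomial k 4 w (U_(i) + U_(@Ordinal 4 3 isT) *+ a)%MM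
  (U_(j) + U_(@Ordinal 4 0 isT) *+ (a + d))%MM.
rewrite !mdegD !mdegMn !mdeg1 !mul1n.
rewrite ifF; last by apply/eqP; lia.
rewrite subr0; apply; last by lia.
- apply/eqP => /(congr1 mdeg); rewrite !mdegD !mdegMn !mdeg1; lia.
- by rewrite !weightD !weightMn !weightU /arith_weight /= e; ring.
Qed.

End Arithmetic.

(** * Matrices given by rows *)

(** Entries of a column indexed by natural numbers, so that a product with a
    matrix given by rows expands to an explicit sum. *)
Definition entry n (v : 'cV[R]_n) (j : nat) : R :=
  if insub j is Some i then v i 0 else 0.

Lemma entryE n (v : 'cV[R]_n) (i : 'I_n) : v i 0 = entry v i.
Proof. by rewrite /entry valK. Qed.

Lemma entry0 n j : entry (0 : 'cV[R]_n) j = 0.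
Proof. by rewrite /entry; case: insub => // i; rewrite mxE. Qed.

Lemma col_entryP n (u v : 'cV[R]_n) :
  (forall j, (j < n)%N -> entry u j = entry v j) -> u = v.
Proof. by move=> e; apply/colP => i; rewrite !entryE e. Qed.

Lemma entry_mulmx m n rows (v : 'cV[R]_n) i : (i < m)%N ->
  entry (mx_of_rows m n rows *m v) i =
  \sum_(0 <= j < n) nth 0 (nth [::] rows i) j * entry v j.
Proof.
move=> lt_i; rewrite -[i]/(val (Ordinal lt_i)) -entryE mxE big_mkord.
by apply: eq_bigr => j _; rewrite !mxE entryE.
Qed.

Definition col_of n (s : seq R) : 'cV[R]_n := mx_of_rows n 1 [seq [:: c] | c <- s].

Lemma entry_col_of n s i : (i < n)%N -> entry (col_of n s) i = s`_i.
Proof.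
move=> lt_i; rewrite -[i]/(val (Ordinal lt_i)) -entryE mxE /=.
have [lt_s|le_s] := ltnP i (size s); first by rewrite (nth_map 0).
by rewrite [nth [::] _ _]nth_default ?size_map // [RHS]nth_default.
Qed.

Lemma mulmx_rows_eq0 m n p r r' :
  (forall i l, (i < m)%N -> (l < p)%N ->
    \sum_(0 <= j < n) nth 0 (nth [::] r i) j * nth 0 (nth [::] r' j) l = 0 :> R) ->
  mx_of_rows m n r *m mx_of_rows n p r' = 0.
Proof.
move=> e; apply/matrixP => i l; rewrite mxE [RHS]mxE -[RHS](e i l) // big_mkord.
by apply: eq_bigr => j _; rewrite !mxE.
Qed.

Lemma exact_at_mulmx m n p (D : 'M[R]_(m, n)) (E : 'M[R]_(n, p)) :
  D *m E = 0 -> (forall v : 'cV_n, D *m v = 0 -> exists u, E *m u = v) ->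
  exact_at (col_map E) (col_map D).
Proof.
move=> DE0 ker v; split=> [/ker //|[u <-]].
by rewrite /col_map /= mulmxA DE0 mul0mx.
Qed.

Lemma row_map_eq0 n (D : 'M[R]_(1, n)) v : row_map D v = 0 <-> D *m v = 0.
Proof.
rewrite /row_map; split=> [e|->]; last by rewrite mxE.
by apply/matrixP => i j; rewrite !ord1 e mxE.
Qed.

Lemma exact_at_row_mulmx n p (D : 'M[R]_(1, n)) (E : 'M[R]_(n, p)) :
  D *m E = 0 -> (forall v : 'cV_n, D *m v = 0 -> exists u, E *m u = v) ->
  exact_at (col_map E) (row_map D).
Proof.
move=> DE0 ker v; split=> [/row_map_eq0/ker //|[u <-]].
by apply/row_map_eq0; rewrite /col_map /= mulmxA DE0 mul0mx.
Qed.

Lemma mulmx_rows_ker m n rows (v : 'cV[R]_n) : mx_of_rows m n rows *m v = 0 ->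
  forall i, (i < m)%N -> \sum_(0 <= j < n) nth 0 (nth [::] rows i) j * entry v j = 0.
Proof.
move=> e i lt_i; rewrite -(entry_mulmx rows v lt_i) e.
by rewrite -[i]/(val (Ordinal lt_i)) -entryE mxE.
Qed.

Lemma mulmx_rows_col_of n p rows s (v : 'cV[R]_n) :
  (forall i, (i < n)%N ->
    \sum_(0 <= j < p) nth 0 (nth [::] rows i) j * s`_j = entry v i) ->
  exists u : 'cV_p, mx_of_rows n p rows *m u = v.
Proof.
move=> e; exists (col_of p s); apply: col_entryP => i lt_i; rewrite entry_mulmx // -e //.
by apply: eq_big_nat => j /andP[_ lt_j]; rewrite entry_col_of.
Qed.

Lemma row_image_ideal n (D : 'M[R]_(1, n)) :
  is_ideal (fun f => exists v, row_map D v = f).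
Proof.
split; first by exists 0; rewrite raddf0.
  by move=> _ _ [v <-] [v' <-]; exists (v + v'); rewrite raddfD.
by move=> c _ [v <-]; exists (c *: v); rewrite linearZ.
Qed.

Lemma row_image_entry n (r : seq R) j : (j < n)%N ->
  exists v, row_map (mx_of_rows 1 n [:: r]) v = r`_j.
Proof.
move=> lt_j; exists (delta_mx (Ordinal lt_j) 0).
by rewrite /row_map -colE !mxE.
Qed.

Lemma row_image_sub (I : R -> Prop) n r (v : 'cV[R]_n) : is_ideal I ->
  (forall f, f \in r -> I f) -> I (row_map (mx_of_rows 1 n [:: r]) v).
Proof.
move=> idI Ir; rewrite /row_map mxE; apply: is_ideal_sum => // j _.
apply: is_idealMr => //; rewrite mxE /=.
have [lt_j|le_j] := ltnP j (size r); first by apply/Ir/mem_nth.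
by rewrite nth_default //; exact: is_ideal0.
Qed.

(** * Exactness at the three free modules *)

Section Exactness.
Variable a : nat.

Let reg := mpoly_regular_variables.

Lemma cubic_yX n f : twisted_cubic x0 x1 x2 y (y ^+ n * f) -> twisted_cubic x0 x1 x2 y f.
Proof.
elim: n => [|n IHn]; first by rewrite mul1r.
by rewrite exprS -mulrA => /(cubic_y reg).
Qed.

Lemma col_map_inj m n (D : 'M[R]_(m, n)) :
  (forall v : 'cV_n, D *m v = 0 -> v = 0) -> injective (col_map D).
Proof. by move=> ker; apply: raddf_inj => v; exact: ker. Qed.

Lemma phi3_inj3 : injective (col_map (phi3 k a 3)).
Proof.
apply: col_map_inj => v /mulmx_rows_ker e.
have := e 1%N isT; have := e 3%N isT; rewrite unlock /= => e3 e1.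
have [||u0 u1] := cubic_second_syzygy reg (p := entry v 0) (q := entry v 1).
- by rewrite -[RHS]oppr0 -e1; ring.
- by rewrite -[RHS]oppr0 -e3; ring.
by apply: col_entryP => -[|[|//]] lt; rewrite entry0.
Qed.

(** The last row says that (v1, v3, v4) is a syzygy of (A, B, C).  The columns of
    phi3 have the two generators of these syzygies there, up to sign; once
    they are subtracted, v0 and v2 satisfy the equations of
    [cubic_second_syzygy]. *)
Lemma phi_exact2_3 : exact_at (col_map (phi3 k a 3)) (col_map (phi2 k a 3)).
Proof.
apply: exact_at_mulmx.
  by apply: mulmx_rows_eq0 => -[|[|[|[|//]]]] [|[|//]] _ _; rewrite unlock /=; ring.
move=> v /mulmx_rows_ker e.
have := (e 0%N isT, e 1%N isT, e 3%N isT); rewrite unlock /= => -[[e0 e1] e3].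
have [|p [q [v1 v3 v4]]] :=
  cubic_syzygy reg (a := entry v 1) (b := entry v 3) (c := entry v 4).
  by rewrite -[RHS]oppr0 -e3; ring.
have [||v0 v2] := cubic_second_syzygy reg
    (p := entry v 0 + y ^+ a.+1 * p) (q := entry v 2 + y ^+ a.+1 * q).
- by rewrite -e0 v1; ring.
- by rewrite -e1 v3; ring.
move/eqP: v0; rewrite addr_eq0 => /eqP v0; move/eqP: v2; rewrite addr_eq0 => /eqP v2.
apply: (mulmx_rows_col_of (s := [:: - p; - q])).
case=> [|[|[|[|[|//]]]]] _; rewrite unlock /=.
- by rewrite v0; ring.
- by rewrite v1; ring.
- by rewrite v2; ring.
- by rewrite v3; ring.
- by rewrite v4; ring.
Qed.

(** As y is regular modulo T, the coefficient v3 of y^(a+1) is in T, and a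
    combination of the columns of phi2 with a nonzero last entry clears it. *)
Lemma phi_exact1_3 : exact_at (col_map (phi2 k a 3)) (row_map (phi1 k a 3)).
Proof.
apply: exact_at_row_mulmx.
  by apply: mulmx_rows_eq0 => -[|//] [|[|[|[|[|//]]]]] _ _; rewrite unlock /=; ring.
move=> v /mulmx_rows_ker/(_ 0%N isT); rewrite unlock /= => e.
have [|p [q [r v3]]] := @cubic_yX a.+1 (entry v 3).
  exists (- entry v 0), (- entry v 1), (- entry v 2).
  by rewrite -[RHS]addr0 -e; ring.
have [|p' [q' [v0 v1 v2]]] := cubic_syzygy reg (a := entry v 0 + y ^+ a.+1 * p)
    (b := entry v 1 + y ^+ a.+1 * q) (c := entry v 2 + y ^+ a.+1 * r).
  by rewrite -e v3; ring.
apply: (mulmx_rows_col_of (s := [:: p'; - p; q'; - q; - r])).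
case=> [|[|[|[|//]]]] _; rewrite unlock /=.
- by rewrite -[RHS](addrK (y ^+ a.+1 * p)) v0; ring.
- by rewrite -[RHS](addrK (y ^+ a.+1 * q)) v1; ring.
- by rewrite -[RHS](addrK (y ^+ a.+1 * r)) v2; ring.
- by rewrite v3; ring.
Qed.

(** The last two rows are the transposed Hilbert-Burch matrix applied to
    (v2, v3, v4). *)
Lemma phi_exact2_2 : exact_at (col_map (phi3 k a 2)) (col_map (phi2 k a 2)).
Proof.
apply: exact_at_mulmx.
  by apply: mulmx_rows_eq0 => -[|[|[|[|[|//]]]]] [|//] _ _;
    rewrite unlock /= ?(exprS _ a); ring.
move=> v /mulmx_rows_ker e.
have := (e 0%N isT, e 1%N isT, e 3%N isT, e 4%N isT);
  rewrite unlock /= ?(exprS _ a) => -[[[e0 e1] e3] e4].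
have [||l [v2 v3 v4]] :=
  cubic_dual_syzygy reg (u := entry v 2) (v := entry v 3) (w := entry v 4).
- by rewrite -e3; ring.
- by rewrite -e4; ring.
have [||v0 v1] := cubic_second_syzygy reg
    (p := entry v 0 - y * y ^+ a * l) (q := entry v 1 - x2 * y ^+ a * l).
- by rewrite -e0; ring.
- by rewrite -e1 v2; ring.
move/subr0_eq: v0 => v0; move/subr0_eq: v1 => v1.
apply: (mulmx_rows_col_of (s := [:: l])).
case=> [|[|[|[|[|//]]]]] _; rewrite unlock /= ?(exprS _ a).
- by rewrite v0; ring.
- by rewrite v1; ring.
- by rewrite v2; ring.
- by rewrite v3; ring.
- by rewrite v4; ring.
Qed.

(** The last two entries of v form a syzygy of x2, y modulo T, and the columns
    of phi2 with a nonzero lower part clear them. *)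
Lemma phi_exact1_2 : exact_at (col_map (phi2 k a 2)) (row_map (phi1 k a 2)).
Proof.
apply: exact_at_row_mulmx.
  by apply: mulmx_rows_eq0 => -[|//] [|[|[|[|[|//]]]]] _ _;
    rewrite unlock /= ?(exprS _ a); ring.
move=> v /mulmx_rows_ker/(_ 0%N isT); rewrite unlock /= ?(exprS _ a) => e.
have [|p [q [r [v3 v4]]]] := cubic_x2y_syzygy reg (d := entry v 3) (e := entry v 4).
  apply: (@cubic_yX a); exists (- entry v 0), (- entry v 1), (- entry v 2).
  by rewrite -[RHS]addr0 -e; ring.
have [|p' [q' [v0 v1 v2]]] := cubic_syzygy reg (a := entry v 0)
    (b := entry v 1 - y ^+ a * p) (c := entry v 2 - y ^+ a * q).
  by rewrite -e v3 v4; ring.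
apply: (mulmx_rows_col_of (s := [:: p'; q'; p; q; r])).
case=> [|[|[|[|[|//]]]]] _; rewrite unlock /= ?(exprS _ a).
- by rewrite v0; ring.
- by rewrite -[RHS](subrK (y ^+ a * p)) v1; ring.
- by rewrite -[RHS](subrK (y ^+ a * q)) v2; ring.
- by rewrite v3; ring.
- by rewrite v4; ring.
Qed.

(** The last three rows only involve the entries other than v0 and v2, and are
    the equations of [cubic_x1x2y_second_syzygy]. *)
Lemma phi_exact2_1 : exact_at (col_map (phi3 k a 1)) (col_map (phi2 k a 1)).
Proof.
apply: exact_at_mulmx.
  by apply: mulmx_rows_eq0 => -[|[|[|[|[|[|//]]]]]] [|[|[|//]]] _ _;
    rewrite unlock /= ?(exprS _ a); ring.
move=> v /mulmx_rows_ker e.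
have := (e 0%N isT, e 1%N isT, e 3%N isT, e 4%N isT, e 5%N isT).
rewrite unlock /= ?(exprS _ a) => -[[[[e0 e1] e3] e4] e5].
have [|||p [q [r [[v1 v3 v4] v5 v6 v7]]]] := cubic_x1x2y_second_syzygy reg (p := entry v 1)
    (q := entry v 3) (r := entry v 4) (s := entry v 5) (t := entry v 6) (u := entry v 7).
- by rewrite -e3; ring.
- by rewrite -e4; ring.
- by rewrite -e5; ring.
have [||v0 v2] := cubic_second_syzygy reg
    (p := entry v 0 - y ^+ a * p) (q := entry v 2 - y ^+ a * q).
- by rewrite -e0 v1; ring.
- by rewrite -e1 v3; ring.
move/subr0_eq: v0 => v0; move/subr0_eq: v2 => v2.
apply: (mulmx_rows_col_of (s := [:: p; q; r])).
case=> [|[|[|[|[|[|[|[|//]]]]]]]] _; rewrite unlock /= ?(exprS _ a).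
- by rewrite v0; ring.
- by rewrite v1; ring.
- by rewrite v2; ring.
- by rewrite v3; ring.
- by rewrite v4; ring.
- by rewrite v5; ring.
- by rewrite v6; ring.
- by rewrite v7; ring.
Qed.

(** The last three entries of v form a syzygy of x1, x2, y modulo T, and the
    columns of phi2 with a nonzero lower part clear them. *)
Lemma phi_exact1_1 : exact_at (col_map (phi2 k a 1)) (row_map (phi1 k a 1)).
Proof.
apply: exact_at_row_mulmx.
  by apply: mulmx_rows_eq0 => -[|//] [|[|[|[|[|[|[|[|//]]]]]]]] _ _;
    rewrite unlock /= ?(exprS _ a); ring.
move=> v /mulmx_rows_ker/(_ 0%N isT); rewrite unlock /= ?(exprS _ a) => e.
have [|p [q [r [s [t [u [v3 v4 v5]]]]]]] :=
    cubic_x1x2y_syzygy reg (d := entry v 3) (e := entry v 4) (f := entry v 5).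
  apply: (@cubic_yX a); exists (- entry v 0), (- entry v 1), (- entry v 2).
  by rewrite -[RHS]addr0 -e; ring.
have [|p' [q' [v0 v1 v2]]] := cubic_syzygy reg (a := entry v 0 - y ^+ a * p)
    (b := entry v 1 - y ^+ a * q) (c := entry v 2 - y ^+ a * r).
  by rewrite -e v3 v4 v5; ring.
apply: (mulmx_rows_col_of (s := [:: p'; p; q'; q; r; s; t; u])).
case=> [|[|[|[|[|[|//]]]]]] _; rewrite unlock /= ?(exprS _ a).
- by rewrite -[RHS](subrK (y ^+ a * p)) v0; ring.
- by rewrite -[RHS](subrK (y ^+ a * q)) v1; ring.
- by rewrite -[RHS](subrK (y ^+ a * r)) v2; ring.
- by rewrite v3; ring.
- by rewrite v4; ring.
- by rewrite v5; ring.
Qed.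

Lemma phi3_inj2 : injective (col_map (phi3 k a 2)).
Proof.
apply: col_map_inj => v /mulmx_rows_ker/(_ 2%N isT); rewrite unlock /= ?(exprS _ a) => e.
apply: col_entryP => -[|//] _; rewrite entry0.
by apply: (mulfI (reg_C_neq0 reg)); rewrite mulr0 -[RHS]oppr0 -e; ring.
Qed.

Lemma phi3_inj1 : injective (col_map (phi3 k a 1)).
Proof.
apply: col_map_inj => v /mulmx_rows_ker e.
have := (e 1%N isT, e 3%N isT, e 7%N isT); rewrite unlock /= ?(exprS _ a) => -[[e1 e3] e7].
have [||u0 u1] := cubic_second_syzygy reg (p := entry v 0) (q := entry v 1).
- by rewrite -[RHS]oppr0 -e1; ring.
- by rewrite -[RHS]oppr0 -e3; ring.
have u2 : entry v 2 = 0.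
  apply: (mulfI (reg_x1_neq0 reg)); rewrite mulr0 -[RHS]e7 u1; ring.
by apply: col_entryP => -[|[|[|//]]] lt; rewrite entry0.
Qed.

End Exactness.

(** * Presentation of the tangent cone *)

Section Presentation.
Variables a b d : nat.
Hypotheses (b_cases : b = 1%N \/ b = 2%N \/ b = 3%N) (d_gt0 : (0 < d)%N).
Hypothesis cop : coprime (3 * a + b) d.
Local Notation w := (arith_weight a b d).
Local Notation TC := (@tangent_cone_ideal k 4 w).

(** The row phi1 for the three values of b at once: the generators are the
    quadrics and x_r y^a for b <= r <= 3, where x_3 = y. *)
Definition cone_generators : seq R :=
  [:: x1 ^+ 2 - x0 * x2; x1 * x2 - x0 * y; x2 ^+ 2 - x1 * y] ++
  [seq [:: 1; x1; x2]`_r * y ^+ a | r <- iota b (3 - b)] ++ [:: y ^+ a.+1].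

Let b_le3 : (b <= 3)%N. Proof. by case: b_cases => [->|[->|->]]. Qed.

Lemma cone_generators_in f : f \in cone_generators -> TC f.
Proof.
rewrite /cone_generators !mem_cat => /or3P[].
- rewrite !inE => /or3P[]/eqP ->; rewrite ?expr2; exact: tangent_cone_quadric.
- case/mapP=> r; rewrite mem_iota subnKC // => /andP[br r3] ->.
  have b_gt0 : (0 < b)%N by case: b_cases => [->|[->|->]].
  have lt_j : (r - b < 4)%N by lia.
  have lt_r : (r < 4)%N by lia.
  have := @tangent_cone_power a b d (Ordinal lt_r) (Ordinal lt_j) d_gt0.
  have -> : [:: 1; x1; x2]`_r = 'X_(Ordinal lt_r).
    case: r r3 lt_r br {lt_j} => [|[|[|//]]] r3 lt_r br; first by lia.
      by congr ('X_ _); exact: val_inj.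
    by congr ('X_ _); exact: val_inj.
  by apply; rewrite /= subnK.
- rewrite inE => /eqP ->; rewrite exprS.
  have lt_j : (3 - b < 4)%N by lia.
  have := @tangent_cone_power a b d (@Ordinal 4 3 isT) (Ordinal lt_j) d_gt0.
  by apply; rewrite /= subnK.
Qed.

Lemma phi1E : phi1 k a b = mx_of_rows 1 (beta1 b) [:: cone_generators].
Proof. by rewrite /cone_generators; case: b_cases => [->|[->|->]]. Qed.

Lemma size_cone_generators : size cone_generators = beta1 b.
Proof. by rewrite /cone_generators; case: b_cases => [->|[->|->]]. Qed.

Lemma tangent_kernel_image f :
  tangent_map w f = 0 -> exists v, row_map (phi1 k a b) v = f.
Proof.
rewrite phi1E; set D := mx_of_rows _ _ _; pose J g := exists v, row_map D v = g.
rewrite -/(J f).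
have Jgen g : g \in cone_generators -> J g.
  move=> /(nthP 0)[j lt_j <-]; apply: row_image_entry.
  by rewrite -size_cone_generators.
apply: (tangent_kernel_sub d_gt0 cop b_le3 (row_image_ideal _)).
- by apply: Jgen; rewrite /cone_generators mem_cat !inE eqxx.
- by apply: Jgen; rewrite /cone_generators mem_cat !inE eqxx orbT.
- by apply: Jgen; rewrite /cone_generators mem_cat !inE eqxx !orbT.
- by apply: Jgen; rewrite /cone_generators !mem_cat !inE eqxx !orbT.
- move=> r br; apply: Jgen; rewrite /cone_generators !mem_cat.
  rewrite (map_f (fun r => [:: 1; x1; x2]`_r * y ^+ a)) ?orbT //.
  by rewrite mem_iota subnKC.
Qed.

Lemma image_tangent_cone v : TC (row_map (phi1 k a b) v).
Proof.
rewrite phi1E; apply: row_image_sub cone_generators_in; exact: ideal_gen_is_ideal.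
Qed.

Lemma tangent_cone_kernel f : tangent_map w f = 0 <-> TC f.
Proof.
split=> [/tangent_kernel_image[v <-]|]; first exact: image_tangent_cone.
exact: tangent_map_tangent_cone.
Qed.

Lemma phi_exact0 : exact_at (row_map (phi1 k a b)) (tangent_surj (k := k) w).
Proof.
move=> f; split=> [|[v <-]]; first exact: tangent_kernel_image.
exact/tangent_cone_kernel/image_tangent_cone.
Qed.

End Presentation.

(** * Minimality *)

Section Minimality.
Variable a : nat.
Hypothesis a_gt0 : (0 < a)%N.
Local Notation V := (@variables_ideal k 4).

Lemma variables_ideal_X j : V 'X_j.
Proof. by apply: ideal_gen_sub; exists j. Qed.

Lemma variables_ideal_exp (f : R) n : (0 < n)%N -> V f -> V (f ^+ n).
Proof. by case: n => // n _ Vf; rewrite exprSr; exact: ideal_genM. Qed.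

Lemma minimal_rows m n (rows : seq (seq R)) :
  (forall r f, r \in rows -> f \in r -> V f) -> minimal_mx (mx_of_rows m n rows).
Proof.
move=> Vrows i j; rewrite mxE.
have [lt_i|le_i] := ltnP i (size rows); last first.
  by rewrite nth_default ?[nth [::] _ _]nth_default //; exact: ideal_gen0.
have [lt_j|le_j] := ltnP j (size (nth [::] rows i)); last first.
  by rewrite nth_default //; exact: ideal_gen0.
by apply: Vrows (mem_nth _ lt_i) (mem_nth _ lt_j).
Qed.

Ltac in_variables_ideal :=
  repeat first
    [ exact: ideal_gen0 | exact: variables_ideal_X | apply: variables_ideal_exp => //
    | apply: ideal_genD | apply: ideal_genN | apply: ideal_genM ].

Lemma phi1_minimal b : minimal_mx (phi1 k a b).
Proof.
case: b => [|[|[|b]]]; apply: minimal_rows => r f; rewrite !inE => /eqP ->;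
  rewrite !inE; do ?[case/orP]; move/eqP ->; in_variables_ideal.
Qed.

Lemma phi2_minimal b : minimal_mx (phi2 k a b).
Proof.
case: b => [|[|[|b]]]; apply: minimal_rows => r f; rewrite !inE;
  do ?[case/orP]; move/eqP ->; rewrite !inE; do ?[case/orP]; move/eqP ->;
  in_variables_ideal.
Qed.

Lemma phi3_minimal b : minimal_mx (phi3 k a b).
Proof.
case: b => [|[|[|b]]]; apply: minimal_rows => r f; rewrite !inE;
  do ?[case/orP]; move/eqP ->; rewrite !inE; do ?[case/orP]; move/eqP ->;
  in_variables_ideal.
Qed.

End Minimality.

End FourVariables.

Lemma coprime_arith a b d :
  \big[gcdn/0%N]_(i < 4) arith_weight a b d i = 1%N -> coprime (3 * a + b) d.
Proof.
move=> e; rewrite /coprime -dvdn1 -[X in (_ %| X)%N]e;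
  apply: (big_ind (fun g => gcdn (3 * a + b) d %| g)%N).
- exact: dvdn0.
- by move=> g g' dg dg'; rewrite dvdn_gcd dg.
- move=> i _; apply: dvdn_add; first exact: dvdn_gcdl.
  exact/dvdn_mull/dvdn_gcdr.
Qed.

(** * The resolution *)

Local Close Scope ring_scope.

Theorem theorem3p1 (k : fieldType) (a b d : nat)
    (ha : (1 <= a)%N) (hd : (1 <= d)%N) (hb : b = 1 \/ b = 2 \/ b = 3)
    (hgcd : \big[gcdn/0%N]_(i < 4) arith_weight a b d i = 1%N) :
  (forall f : {mpoly k[4]},
     tangent_surj (arith_weight a b d) f = 0%R <->
     tangent_cone_ideal (arith_weight a b d) f) /\
  minimal_free_resolution (phi3 k a b) (phi2 k a b) (phi1 k a b)
    (tangent_surj (arith_weight a b d)).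
Proof.
have cop := coprime_arith hgcd.
split; first by move=> f; exact: tangent_cone_kernel.
split.
- by case: hb => [->|[->|->]]; [exact: phi3_inj1 | exact: phi3_inj2 | exact: phi3_inj3].
- by case: hb => [->|[->|->]];
    [exact: phi_exact2_1 | exact: phi_exact2_2 | exact: phi_exact2_3].
- by case: hb => [->|[->|->]];
    [exact: phi_exact1_1 | exact: phi_exact1_2 | exact: phi_exact1_3].
- exact: phi_exact0.
- exact: tangent_map_surj.
- exact: phi1_minimal.
- exact: phi2_minimal.
- exact: phi3_minimal.
Qed.
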